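(* Consider the smart-metering model described in the context with infinite horizon. Suppose there exist a constant $J\in\mathbb R$ and a function $v:\mathcal P_{X,S}\to\mathbb R$ satisfying $$J+v(\pi)=\min_{a\in\mathcal A}[\mathscr B_a v](\pi)\qquad\forall \pi\in\mathcal P_{X,S}.$$ Let $f^*(\pi)$ denote a minimizer of the right-hand side. Then the time-homogeneous policy $\mathbf q^*$ given by $q^*(y\mid x_t,s_t,\pi_t)=a(y\mid x_t,s_t)$ with $a=f^*(\pi_t)$ (where $\pi_t$ is the belief state) is optimal, i.e. it minimizes $L_\infty$ over $\mathcal Q_A$; hence there is no loss of optimality in restricting to time-homogeneous policies of the form $q(y_t\mid x_t,s_t,\pi_t)$. Moreover the optimal infinite-horizon leakage rate $\inf_{\mathbf q\in\mathcal Q_A}L_\infty(\mathbf q)$ equals $J$.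
   Context: Let $\mathcal X=\{0,\dots,m_x\}$, $\mathcal Y=\{0,\dots,m_y\}$, $\mathcal S=\{0,\dots,m_s\}$ with $m_x\le m_y$. The demand $\{X_t\}_{t\ge1}$ is a time-homogeneous first-order Markov chain on $\mathcal X$ with irreducible aperiodic transition matrix $Q(x'\mid x)$ and initial pmf $P_{X_1}$; the initial battery charge $S_1\in\mathcal S$ has pmf $P_{S_1}$ and is independent of $\{X_t\}$. For an integer $w$ let $\mathcal Y_\circ(w)=\{y\in\mathcal Y: w+y\in\mathcal S\}$. A charging policy $\mathbf q=(q_1,q_2,\dots)$ is a sequence of conditional pmfs $q_t(y\mid x^t,s^t,y^{t-1})$ on $\mathcal Y$ with $\sum_{y\in\mathcal Y_\circ(s_t-x_t)}q_t(y\mid x^t,s^t,y^{t-1})=1$; $\mathcal Q_A$ is the set of all such policies. The joint law is $P^{\mathbf q}(s^T,x^T,y^T)=P_{S_1}(s_1)P_{X_1}(x_1)q_1(y_1|x_1,s_1)\prod_{t=2}^T\mathbf 1\{s_t=s_{t-1}-x_{t-1}+y_{t-1}\}Q(x_t|x_{t-1})q_t(y_t|x^t,s^t,y^{t-1})$. Leakage rates: $L_T(\mathbf q)=\frac1T I^{\mathbf q}(X^T,S_1;Y^T)$ and $L_\infty(\mathbf q)=\limsup_{T\to\infty}L_T(\mathbf q)$. $\mathcal P_{X,S}$ is the set of pmfs on $\mathcal X\times\mathcal S$; $\mathcal A$ is the set of conditional pmfs $a(y\mid x,s)$ with $a(\mathcal Y_\circ(s-x)\mid x,s)=1$ for all $(x,s)$.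 $I(a;\pi)$ is the mutual information between $(X,S)\sim\pi$ and $Y\sim a(\cdot\mid X,S)$. The filter is $\varphi(\pi,y,a)(x',s')=\frac{\sum_{x}Q(x'|x)a(y|x,s'+x-y)\pi(x,s'+x-y)}{\sum_{x,s}a(y|x,s)\pi(x,s)}$ (terms with $s'+x-y\notin\mathcal S$ are zero; arbitrary pmf if the denominator vanishes), and $[\mathscr B_aV](\pi)=I(a;\pi)+\sum_{x,s,y}\pi(x,s)a(y|x,s)V(\varphi(\pi,y,a))$. The belief state is $\pi_t(x,s)=P^{\mathbf q}(X_t=x,S_t=s\mid Y^{t-1}=y^{t-1})$, updated by $\pi_{t+1}=\varphi(\pi_t,y_t,a_t)$. *)

(* Defs.v *)
From HB Require Import structures.
From mathcomp Require Import all_boot all_order all_algebra.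
From mathcomp Require Import all_classical all_reals all_analysis.
Set Implicit Arguments. Unset Strict Implicit. Unset Printing Implicit Defensive.
Import Order.TTheory GRing.Theory Num.Theory.
Local Open Scope ring_scope.

(* Alphabets: X = {0..mx} = 'I_mx.+1, Y = 'I_my.+1, S = 'I_ms.+1.
   Q is a square matrix with  Q x x' = Q(x' | x).
   A pmf on X x S is a function pi : X -> S -> R, written pi x s.
   A conditional pmf a(y|x,s) is a function a : X -> S -> Y -> R, a x s y. *)

Definition stochastic (R : realType) (n : nat) (Q : 'M[R]_n.+1) : Prop :=
  (forall i j, 0 <= Q i j) /\ (forall i, \sum_j Q i j = 1).

Definition irreducible (R : realType) (n : nat) (Q : 'M[R]_n.+1) : Prop :=
  forall i j, exists k : nat, 0 < (Q ^+ k) i j.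

(* aperiodic: for every state, the gcd of the return times
   {k > 0 | Q^k(i,i) > 0} is 1, i.e. every common divisor is 1 *)
Definition aperiodic (R : realType) (n : nat) (Q : 'M[R]_n.+1) : Prop :=
  forall i (d : nat),
    (forall k : nat, (0 < k)%N -> 0 < (Q ^+ k) i i -> (d %| k)%N) -> d = 1%N.

Definition is_pmf (R : realType) (T : finType) (p : T -> R) : Prop :=
  (forall t, 0 <= p t) /\ \sum_t p t = 1.

Definition is_pmfXS (R : realType) (mx ms : nat)
  (pi : 'I_mx.+1 -> 'I_ms.+1 -> R) : Prop :=
  (forall x s, 0 <= pi x s) /\ \sum_x \sum_s pi x s = 1.

(* y is in Y_o(s - x), i.e. s - x + y lies in {0..ms} *)
Definition feasible (ms : nat) (s x y : nat) : bool :=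
  (x <= s + y)%N && (s + y <= ms + x)%N.

Definition admissible (R : realType) (mx my ms : nat)
  (a : 'I_mx.+1 -> 'I_ms.+1 -> 'I_my.+1 -> R) : Prop :=
  forall x s, (forall y, 0 <= a x s y) /\ \sum_y a x s y = 1 /\
              \sum_(y : 'I_my.+1 | feasible ms s x y) a x s y = 1.

(* mutual information of a joint pmf p on A x B (natural log, 0 log 0 = 0) *)
Definition MI (R : realType) (A B : finType) (p : A -> B -> R) : R :=
  \sum_a \sum_b (if p a b == 0 then 0 else
     p a b * ln (p a b / ((\sum_b' p a b') * (\sum_a' p a' b)))).

Definition Iact (R : realType) (mx my ms : nat)
  (a : 'I_mx.+1 -> 'I_ms.+1 -> 'I_my.+1 -> R) (pi : 'I_mx.+1 -> 'I_ms.+1 -> R) : R :=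
  MI (fun (xs : 'I_mx.+1 * 'I_ms.+1) (y : 'I_my.+1) => pi xs.1 xs.2 * a xs.1 xs.2 y).

Definition prevS (ms : nat) (s' x y : nat) : option 'I_ms.+1 :=
  if (y <= s' + x)%N then insub (s' + x - y)%N else None.

(* the filter phi(pi,y,a); phi0 is the (arbitrary) pmf used when the
   denominator vanishes *)
Definition filt (R : realType) (mx my ms : nat) (Q : 'M[R]_mx.+1)
  (phi0 : ('I_mx.+1 -> 'I_ms.+1 -> R) -> 'I_my.+1 ->
          ('I_mx.+1 -> 'I_ms.+1 -> 'I_my.+1 -> R) -> 'I_mx.+1 -> 'I_ms.+1 -> R)
  (pi : 'I_mx.+1 -> 'I_ms.+1 -> R) (y : 'I_my.+1)
  (a : 'I_mx.+1 -> 'I_ms.+1 -> 'I_my.+1 -> R) : 'I_mx.+1 -> 'I_ms.+1 -> R :=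
  let den := \sum_x \sum_s a x s y * pi x s in
  if den == 0 then phi0 pi y a else
  fun x' s' => (\sum_(x : 'I_mx.+1) match prevS ms s' x y with
                        | Some s => Q x x' * a x s y * pi x s
                        | None => 0 end) / den.

Definition bellman (R : realType) (mx my ms : nat) (Q : 'M[R]_mx.+1)
  (phi0 : ('I_mx.+1 -> 'I_ms.+1 -> R) -> 'I_my.+1 ->
          ('I_mx.+1 -> 'I_ms.+1 -> 'I_my.+1 -> R) -> 'I_mx.+1 -> 'I_ms.+1 -> R)
  (a : 'I_mx.+1 -> 'I_ms.+1 -> 'I_my.+1 -> R)
  (V : ('I_mx.+1 -> 'I_ms.+1 -> R) -> R) (pi : 'I_mx.+1 -> 'I_ms.+1 -> R) : R :=
  Iact a pi + \sum_x \sum_s \sum_y pi x s * a x s y * V (filt Q phi0 pi y a).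

(* A charging policy: q t xs ss ys y = q_{t+1}(y | x^{t+1}, s^{t+1}, y^t)
   (time index t is 0-based: q 0 is q_1), histories given as sequences. *)
Definition policy (R : realType) (mx my ms : nat) :=
  nat -> seq 'I_mx.+1 -> seq 'I_ms.+1 -> seq 'I_my.+1 -> 'I_my.+1 -> R.

Definition valid_policy (R : realType) (mx my ms : nat) (q : policy R mx my ms) : Prop :=
  forall (t : nat) xs ss ys, size xs = t.+1 -> size ss = t.+1 -> size ys = t ->
    (forall y, 0 <= q t xs ss ys y) /\ \sum_y q t xs ss ys y = 1 /\
    \sum_(y : 'I_my.+1 | feasible ms (nth ord0 ss t) (nth ord0 xs t) y) q t xs ss ys y = 1.

Definition jointP (R : realType) (mx my ms : nat) (Q : 'M[R]_mx.+1)
  (PX1 : 'I_mx.+1 -> R) (PS1 : 'I_ms.+1 -> R) (q : policy R mx my ms) (T : nat)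
  (xs : seq 'I_mx.+1) (ss : seq 'I_ms.+1) (ys : seq 'I_my.+1) : R :=
  \prod_(t < T)
    ((if t == 0%N :> nat then PS1 (nth ord0 ss 0) * PX1 (nth ord0 xs 0)
      else ((nth ord0 ss t + nth ord0 xs t.-1 ==
             nth ord0 ss t.-1 + nth ord0 ys t.-1)%N)%:R
           * Q (nth ord0 xs t.-1) (nth ord0 xs t))
     * q t (take t.+1 xs) (take t.+1 ss) (take t ys) (nth ord0 ys t)).

Definition jointXS1Y (R : realType) (mx my ms : nat) (Q : 'M[R]_mx.+1)
  (PX1 : 'I_mx.+1 -> R) (PS1 : 'I_ms.+1 -> R) (q : policy R mx my ms) (T : nat)
  (xs1 : T.-tuple 'I_mx.+1 * 'I_ms.+1) (ys : T.-tuple 'I_my.+1) : R :=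
  \sum_(ss : T.-tuple 'I_ms.+1 | nth ord0 ss 0 == xs1.2)
    jointP Q PX1 PS1 q T xs1.1 ss ys.

Definition leakT (R : realType) (mx my ms : nat) (Q : 'M[R]_mx.+1)
  (PX1 : 'I_mx.+1 -> R) (PS1 : 'I_ms.+1 -> R) (q : policy R mx my ms) (T : nat) : R :=
  MI (@jointXS1Y R mx my ms Q PX1 PS1 q T) / T%:R.

Definition leakInf (R : realType) (mx my ms : nat) (Q : 'M[R]_mx.+1)
  (PX1 : 'I_mx.+1 -> R) (PS1 : 'I_ms.+1 -> R) (q : policy R mx my ms) : \bar R :=
  limn_esup (fun T => (leakT Q PX1 PS1 q T)%:E).

(* belief state pi_{t+1} after observing y^t, when at each step the action
   f(pi_t) is used; pi_1 = P_{X_1} x P_{S_1} *)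
Definition belief (R : realType) (mx my ms : nat) (Q : 'M[R]_mx.+1)
  (PX1 : 'I_mx.+1 -> R) (PS1 : 'I_ms.+1 -> R)
  (phi0 : ('I_mx.+1 -> 'I_ms.+1 -> R) -> 'I_my.+1 ->
          ('I_mx.+1 -> 'I_ms.+1 -> 'I_my.+1 -> R) -> 'I_mx.+1 -> 'I_ms.+1 -> R)
  (f : ('I_mx.+1 -> 'I_ms.+1 -> R) -> 'I_mx.+1 -> 'I_ms.+1 -> 'I_my.+1 -> R)
  (ys : seq 'I_my.+1) : 'I_mx.+1 -> 'I_ms.+1 -> R :=
  foldl (fun pi y => filt Q phi0 pi y (f pi)) (fun x s => PX1 x * PS1 s) ys.

Definition belief_policy (R : realType) (mx my ms : nat) (Q : 'M[R]_mx.+1)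
  (PX1 : 'I_mx.+1 -> R) (PS1 : 'I_ms.+1 -> R)
  (phi0 : ('I_mx.+1 -> 'I_ms.+1 -> R) -> 'I_my.+1 ->
          ('I_mx.+1 -> 'I_ms.+1 -> 'I_my.+1 -> R) -> 'I_mx.+1 -> 'I_ms.+1 -> R)
  (f : ('I_mx.+1 -> 'I_ms.+1 -> R) -> 'I_mx.+1 -> 'I_ms.+1 -> 'I_my.+1 -> R)
  : policy R mx my ms :=
  fun t xs ss ys y =>
    f (belief Q PX1 PS1 phi0 f ys) (nth ord0 xs t) (nth ord0 ss t) y.

(* Main.v *)
Require Import Defs.
From HB Require Import structures.
From mathcomp Require Import all_boot all_order all_algebra.
From mathcomp Require Import all_classical all_reals all_analysis.
From mathcomp Require Import zify ring lra.
Import Order.TTheory GRing.Theory Num.Theory.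
Local Open Scope ring_scope.

(** The chain rule splits [I(X^T, S_1; Y^T)] into per-step gains, each at least the
    mean of [I(a_t; pi_t)] (data processing), with equality for belief policies.
    Iterating the optimality equation gives
    [J T + v(pi_1) <= I(X^T, S_1; Y^T) + E v(pi_(T+1))], with equality for the
    minimizing policy, so the theorem holds as soon as [v] is bounded along the
    belief process.

    The function [v] is not assumed bounded, but the equation forces it to be.
    From above: from any belief the battery charge can be disclosed in boundedly
    many steps (up to a letter that leaves the charge distribution unchanged), so
    that the belief ends in a finite set. From below: any belief of the process is
    reached from a fixed belief in boundedly many steps with a probability bounded
    away from 0. The only obstacle is a state where the letter is forced, namely
    zero demand with a full battery, or its mirror image; the weight of that state
    has to be prepared by an earlier letter.

    If the demand is constant then [I(X^T, S_1; Y^T)] is bounded and [J = 0]. *)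

Set Implicit Arguments. Unset Strict Implicit. Unset Printing Implicit Defensive.

(** One inequality drives both bounds: [v(p) <= C + E v(posterior)] for every admissible action.
    Bounding the posteriors of a well-chosen action bounds [v(p)] from above; inserting the upper
    bound for all letters but one bounds [v] from below at the posterior of the remaining letter.
    The lower bound rests on the fact that a posterior depends on the belief [p] and the letter
    weights [h] only through the product [h * p], up to a scalar. A fixed belief [q] thus reaches
    the posterior of another belief [p] as soon as the weights [h * p / q], suitably scaled, are
    admissible. A weight may be lowered wherever another letter is feasible; where the letter is
    forced it must be 1, which prescribes the weight of that state in [q] exactly. The charge cannot
    be disclosed in one letter, because for [mx = my] there are no letters to spare: hiding the
    parity of the demand frees one bit per letter for the charge. *)

Section FiniteFamilies.
Variable (R : realType).

Lemma finite_upper_bound (I : finType) (F : I -> R) :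
  exists2 B, 0 <= B & forall i, F i <= B.
Proof.
exists (\sum_i `|F i|); first exact: sumr_ge0.
by move=> i; rewrite (bigD1 i) //= (le_trans (ler_norm _)) // lerDl sumr_ge0.
Qed.

Lemma sum_gt0_exists (I : finType) (F : I -> R) :
  0 < \sum_i F i -> exists i, 0 < F i.
Proof.
move=> S0; apply: contrapT => nF; move: S0; rewrite ltNge => /negP; apply.
apply: sumr_le0 => i _; rewrite leNgt; apply/negP => Fi; apply: nF; by exists i.
Qed.

End FiniteFamilies.

Lemma feasible_next (ms s x y s' : nat) : (s + y = s' + x)%N -> (s' <= ms)%N ->
  feasible ms s x y.
Proof. by rewrite /feasible; lia. Qed.

(** * Belief updates *)

Section Filter.
Variables (R : realType) (mx my ms : nat) (Q : 'M[R]_mx.+1).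
Local Notation X := 'I_mx.+1.
Local Notation Y := 'I_my.+1.
Local Notation S := 'I_ms.+1.
Implicit Types (p h G : X -> S -> R) (y : Y) (a : X -> S -> Y -> R).

Definition mass h p : R := \sum_x \sum_s h x s * p x s.

(** Unnormalized filter for a single letter. It sees the action only through the weights [h x s] of
    [y], so one letter can be treated without fixing the rest of the action. *)
Definition push h p (y : Y) : X -> S -> R := fun x' s' =>
  \sum_(x : X) \sum_(s : S | (s + y == s' + x)%N) Q x x' * h x s * p x s.

Definition post p (y : Y) h : X -> S -> R := fun x' s' => push h p y x' s' / mass h p.

Definition kernel_at a (y : Y) : X -> S -> R := fun x s => a x s y.

Lemma prevSE (s' : S) (x : X) (y : Y) (F : S -> R) :
  (match prevS ms s' x y with Some s => F s | None => 0 end) =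
  \sum_(s : S | (s + y == s' + x)%N) F s.
Proof.
rewrite /prevS; case: leqP => hy; last first.
  by rewrite big_pred0 // => s; apply/negbTE; lia.
case: insubP => /= [s hs es | hs].
  rewrite (big_pred1 s) // => t /=; apply/eqP/eqP => [e|->]; last by lia.
  by apply/val_inj => /=; lia.
by rewrite big_pred0 // => s; apply/negbTE; have := ltn_ord s; move: hs; lia.
Qed.

Lemma filtE phi0 p y a : mass (kernel_at a y) p != 0 ->
  filt Q phi0 p y a = post p y (kernel_at a y).
Proof.
move=> m0; rewrite /filt -/(mass (kernel_at a y) p) (negbTE m0).
apply/funext => x'; apply/funext => s'; congr (_ / _).
by apply: eq_bigr => x _; rewrite prevSE.
Qed.

Lemma push_ge0 h p y : (forall i j, 0 <= Q i j) -> (forall x s, 0 <= h x s) ->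
  (forall x s, 0 <= p x s) -> forall x' s', 0 <= push h p y x' s'.
Proof.
move=> Q0 h0 p0 x' s'; apply: sumr_ge0 => x _; apply: sumr_ge0 => s _.
by rewrite !mulr_ge0.
Qed.

(** Adjoint form: [G] at the new state is replaced by its one-step average at the old one. [G = 1]
    gives the total mass; the weights of a later letter as [G] are pulled back one step. *)
Lemma push_sum h p y G :
  \sum_x' \sum_s' G x' s' * push h p y x' s' =
  \sum_x \sum_s h x s * p x s *
     \sum_x' Q x x' * \sum_(s' : S | (s + y == s' + x)%N) G x' s'.
Proof.
under eq_bigr => x' _.
  under eq_bigr => s' _.
    rewrite mulr_sumr.
    under eq_bigr => x _ do rewrite mulr_sumr big_mkcond /=.
    over.
  rewrite exchange_big /=.
  under eq_bigr => x _ do rewrite exchange_big /=.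
  over.
rewrite exchange_big /=; apply: eq_bigr => x _.
rewrite exchange_big /=; apply: eq_bigr => s _.
rewrite mulr_sumr; apply: eq_bigr => x' _.
rewrite !mulr_sumr [RHS]big_mkcond /=; apply: eq_bigr => s' _.
by case: ifP => // _; ring.
Qed.

Lemma sum_next_const (s : S) (x : X) (y : Y) (c : R) :
  \sum_(s' : S | (s + y == s' + x)%N) c = if feasible ms s x y then c else 0.
Proof.
rewrite /feasible; case: ifP => hf; last first.
  rewrite big_pred0 // => s'; apply/negbTE; have := ltn_ord s'; move: hf; lia.
have hlt : (s + y - x < ms.+1)%N by move: hf; lia.
rewrite (big_pred1 (Ordinal hlt)) // => t /=; apply/eqP/eqP => [e|->] /=.
  by apply/val_inj => /=; move: hf; lia.
by move: hf => /=; lia.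
Qed.

Hypothesis stoQ : stochastic Q.

Lemma sto_ge0 i j : 0 <= Q i j. Proof. by case: stoQ. Qed.

Lemma sto_sum i : \sum_j Q i j = 1. Proof. by case: stoQ. Qed.

Lemma sto_le1 i j : Q i j <= 1.
Proof.
rewrite -(sto_sum i) (bigD1 j) //= lerDl; apply: sumr_ge0 => k _; exact: sto_ge0.
Qed.

Lemma mass_push h p y : (forall x s, h x s != 0 -> feasible ms s x y) ->
  \sum_x' \sum_s' push h p y x' s' = mass h p.
Proof.
move=> hf; transitivity (\sum_x' \sum_s' 1 * push h p y x' s').
  by apply: eq_bigr => ? _; apply: eq_bigr => ? _; rewrite mul1r.
rewrite (push_sum h p y (fun _ _ => 1)).
apply: eq_bigr => x _; apply: eq_bigr => s _.
have [->|hn] := eqVneq (h x s) 0; first by rewrite !mul0r.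
under eq_bigr => x' _ do rewrite sum_next_const hf // mulr1.
by rewrite sto_sum mulr1.
Qed.

Lemma mass_ge0 h p : (forall x s, 0 <= h x s) ->
  (forall x s, 0 <= p x s) -> 0 <= mass h p.
Proof.
by move=> h0 p0; apply: sumr_ge0 => x _; apply: sumr_ge0 => s _; rewrite mulr_ge0.
Qed.

Lemma mass_ge_term h p x s : (forall x s, 0 <= h x s) ->
  (forall x s, 0 <= p x s) -> h x s * p x s <= mass h p.
Proof.
move=> h0 p0; rewrite /mass (bigD1 x) //= (bigD1 s) //= -addrA lerDl addr_ge0 //.
  by apply: sumr_ge0 => i _; rewrite mulr_ge0.
by apply: sumr_ge0 => i _; apply: sumr_ge0 => j _; rewrite mulr_ge0.
Qed.

Lemma mass_gt0_exists h p : 0 < mass h p -> exists x s, 0 < h x s * p x s.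
Proof. by move=> /sum_gt0_exists[x /sum_gt0_exists[s ?]]; exists x, s. Qed.

Lemma pmf_post h p y : (forall x s, 0 <= h x s) ->
  (forall x s, h x s != 0 -> feasible ms s x y) -> is_pmfXS p -> 0 < mass h p ->
  is_pmfXS (post p y h).
Proof.
move=> h0 hf [p0 _] m0; split.
  by move=> x s; rewrite divr_ge0 // ?(ltW m0) // push_ge0 //; exact: sto_ge0.
under eq_bigr => x _ do rewrite -mulr_suml.
by rewrite -mulr_suml mass_push // divff // gt_eqF.
Qed.

(** Numerator and denominator are linear in the product [h * p], so a common factor cancels. This is
    how a belief is exchanged below for a more convenient one. *)
Lemma post_ext h1 p1 h2 p2 y k : k != 0 ->
  (forall x s, h1 x s * p1 x s = k * (h2 x s * p2 x s)) ->
  post p1 y h1 = post p2 y h2.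
Proof.
move=> k0 e; apply/funext => x'; apply/funext => s'; rewrite /post.
have -> : push h1 p1 y x' s' = k * push h2 p2 y x' s'.
  rewrite /push mulr_sumr; apply: eq_bigr => x _.
  rewrite mulr_sumr; apply: eq_bigr => s _.
  by rewrite -mulrA e; ring.
have -> : mass h1 p1 = k * mass h2 p2.
  rewrite /mass mulr_sumr; apply: eq_bigr => x _.
  by rewrite mulr_sumr; apply: eq_bigr => s _; rewrite e.
by rewrite -mulf_div divff // mul1r.
Qed.

Lemma mass_scale h1 p1 h2 p2 k :
  (forall x s, h1 x s * p1 x s = k * (h2 x s * p2 x s)) ->
  mass h1 p1 = k * mass h2 p2.
Proof.
move=> e; rewrite /mass mulr_sumr; apply: eq_bigr => x _.
by rewrite mulr_sumr; apply: eq_bigr => s _; rewrite e.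
Qed.

Lemma push_neq0 h p y x' s' : push h p y x' s' != 0 ->
  exists x s, [/\ Q x x' != 0, h x s != 0, p x s != 0 & (s + y = s' + x)%N].
Proof.
move=> pn; apply: contrapT => nE; move/eqP: pn; apply.
apply: big1 => x _; apply: big1 => s /eqP e.
have [->|q0] := eqVneq (Q x x') 0; first by rewrite !mul0r.
have [->|h0] := eqVneq (h x s) 0; first by rewrite mulr0 mul0r.
have [->|p0] := eqVneq (p x s) 0; first by rewrite mulr0.
by exfalso; apply: nE; exists x, s.
Qed.

Lemma post_neq0 h p y x' s' : post p y h x' s' != 0 ->
  exists x s, [/\ Q x x' != 0, h x s != 0, p x s != 0 & (s + y = s' + x)%N].
Proof. by rewrite mulf_eq0 => /norP[/push_neq0]. Qed.

End Filter.

(** * The Bellman operator as a sum over letters *)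

Section BellmanInequality.
Variables (R : realType) (mx my ms : nat) (Q : 'M[R]_mx.+1).
Local Notation X := 'I_mx.+1.
Local Notation Y := 'I_my.+1.
Local Notation S := 'I_ms.+1.

Lemma admissible_feasible (a : X -> S -> Y -> R) x s y :
  admissible a -> a x s y != 0 -> feasible ms s x y.
Proof.
move=> /(_ x s)[a0 [s1 s2]] an; apply: contraT => nf.
have : \sum_(y' : Y | ~~ feasible ms s x y') a x s y' = 0.
  move: s1; rewrite (bigID (fun y' : Y => feasible ms s x y')) /= s2.
  by move/(canRL (addKr _)); rewrite addNr.
move/psumr_eq0P => /(_ (fun y' _ => a0 y')) /(_ y nf) e.
by rewrite e eqxx in an.
Qed.

Lemma mass_le1 (h p : X -> S -> R) : (forall x s, h x s <= 1) -> is_pmfXS p ->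
  mass h p <= 1.
Proof.
move=> h1 [p0 <-]; apply: ler_sum => x _; apply: ler_sum => s _.
by rewrite ler_piMl.
Qed.

Lemma sum_mass (a : X -> S -> Y -> R) p : admissible a -> is_pmfXS p ->
  \sum_y mass (kernel_at a y) p = 1.
Proof.
move=> aa [_ <-]; rewrite /mass exchange_big /=; apply: eq_bigr => x _.
rewrite exchange_big /=; apply: eq_bigr => s _.
by rewrite -mulr_suml; case: (aa x s) => _ [-> _]; rewrite mul1r.
Qed.

Lemma bellman_massE phi0 (a : X -> S -> Y -> R) v p :
  bellman Q phi0 a v p =
  Iact a p + \sum_y mass (kernel_at a y) p * v (filt Q phi0 p y a).
Proof.
rewrite /bellman; congr (_ + _); rewrite /mass.
transitivity (\sum_x \sum_y \sum_s p x s * a x s y * v (filt Q phi0 p y a)).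
  by apply: eq_bigr => x _; rewrite exchange_big.
rewrite exchange_big /=; apply: eq_bigr => y _.
rewrite mulr_suml; apply: eq_bigr => x _; rewrite mulr_suml; apply: eq_bigr => s _.
by rewrite /kernel_at; ring.
Qed.

(** The arbitrary pmf [phi0] disappears, since it only enters at letters of probability 0. *)
Lemma bellman_postE phi0 (a : X -> S -> Y -> R) v p :
  bellman Q phi0 a v p =
  Iact a p + \sum_y mass (kernel_at a y) p * v (post Q p y (kernel_at a y)).
Proof.
rewrite bellman_massE; congr (_ + _); apply: eq_bigr => y _.
have [->|m0] := eqVneq (mass (kernel_at a y) p) 0; first by rewrite !mul0r.
by rewrite filtE.
Qed.

End BellmanInequality.

(** * Upper bound on the value function *)

(** Charge arithmetic of the disclosure moves, here and in the next three lemmas: [t] is the charge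
    before a letter and [s] after it; the letter adds its bit and the demand removes its parity
    [b]. *)
Lemma query_true_range (a t s L : nat) (b : bool) : (a <= t <= a + L.+2)%N ->
  (t <= a)%N = true -> (t + (t <= a) = s + b)%N -> (a <= s <= a + 1)%N.
Proof. by case: b => /=; lia. Qed.

Lemma query_false_range (a t s L : nat) (b : bool) : (a <= t <= a + L.+2)%N ->
  t <> a.+1 -> (t <= a)%N = false -> (t + (t <= a) = s + b)%N ->
  (a.+1 <= s <= a.+1 + L.+1)%N.
Proof. by case: b => /=; lia. Qed.

Lemma flip_range (a t s L : nat) (b : bool) : (a <= t <= a + L.+2)%N ->
  (t + (if t == a.+1 then ~~ b else b) = s + b)%N ->
  (a <= s <= a + L.+2)%N /\ s <> a.+1.
Proof. by case: eqP; case: b => /=; lia. Qed.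

Lemma query_determined (a s : nat) (o : bool) : (a <= s <= a + 1)%N ->
  (s <= a)%N = o -> s = if o then a else a.+1.
Proof. by case: o; lia. Qed.

Section UpperBound.
Variables (R : realType) (mx my ms : nat) (Q : 'M[R]_mx.+1).
Local Notation X := 'I_mx.+1.
Local Notation Y := 'I_my.+1.
Local Notation S := 'I_ms.+1.

Definition det_action (d : X -> S -> Y) : X -> S -> Y -> R :=
  fun x s y => (y == d x s)%:R.

Lemma det_action_admissible (d : X -> S -> Y) : (forall (x : X) (s : S), feasible ms s x (d x s)) ->
  admissible (det_action d).
Proof.
move=> df x s; split; first by move=> y; rewrite ler0n.
rewrite /det_action; split; last rewrite big_mkcond /=.
  rewrite (bigD1 (d x s)) //= eqxx big1 ?addr0 // => y /negbTE -> //.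
rewrite (bigD1 (d x s)) //= eqxx df big1 ?addr0 // => y /negbTE ->.
by case: ifP.
Qed.

Lemma det_post_support (d : X -> S -> Y) p (y : Y) x' s' :
  post Q p y (kernel_at (det_action d) y) x' s' != 0 ->
  exists x s, [/\ p x s != 0, y = d x s & (s + y = s' + x)%N].
Proof.
move=> /post_neq0[x [s [_ hn pn e]]]; exists x, s; split=> //.
apply/eqP; move: hn; rewrite /kernel_at /det_action.
by case: (y == d x s) => //; rewrite eqxx.
Qed.

(** Belief right after the demand [x0] has been disclosed, when the charge has a law [sg]
    independent of the next demand. *)
Definition prod_belief (x0 : X) (sg : S -> R) : X -> S -> R :=
  fun x s => Q x0 x * sg s.

Hypothesis le_mx_my : (mx <= my)%N.

Definition hold_letter (x : X) (_ : S) : Y := inord x.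

Lemma hold_letterE (x : X) (s : S) : hold_letter x s = x :> nat.
Proof. by rewrite /hold_letter inordK //; have := ltn_ord x; lia. Qed.

Lemma hold_feasible (x : X) (s : S) : feasible ms s x (hold_letter x s).
Proof. by rewrite /feasible hold_letterE; have := ltn_ord s; lia. Qed.

Variables (v : (X -> S -> R) -> R) (C : R).
Hypotheses (stoQ : stochastic Q) (C0 : 0 <= C).
Hypothesis vB : forall p (a : X -> S -> Y -> R), is_pmfXS p -> admissible a ->
  v p <= C + \sum_y mass (kernel_at a y) p * v (post Q p y (kernel_at a y)).

Lemma pmf_prod_belief x0 sg : is_pmf sg -> is_pmfXS (prod_belief x0 sg).
Proof.
move=> [sg0 sg1]; split=> [x s|]; first by rewrite mulr_ge0 // sto_ge0.
under eq_bigr => x _ do rewrite -mulr_sumr sg1 mulr1.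
exact: sto_sum.
Qed.

Lemma det_bound (d : X -> S -> Y) p B : is_pmfXS p -> (forall (x : X) (s : S), feasible ms s x (d x s)) ->
  0 <= B ->
  (forall y, 0 < mass (kernel_at (det_action d) y) p ->
     v (post Q p y (kernel_at (det_action d) y)) <= B) ->
  v p <= C + B.
Proof.
move=> pp df B0 H; have da := det_action_admissible df.
apply: (le_trans (vB pp da)); rewrite lerD2l.
rewrite -[leRHS]mul1r -(sum_mass da pp) mulr_suml; apply: ler_sum => y _.
have m0 : 0 <= mass (kernel_at (det_action d) y) p.
  by case: pp => p0 _; apply: mass_ge0 => // x s; rewrite /kernel_at /det_action ler0n.
have [->|mn] := eqVneq (mass (kernel_at (det_action d) y) p) 0; first by rewrite !mul0r.
by rewrite ler_wpM2l // H // lt0r mn.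
Qed.

Lemma post_hold p (x1 : X) : 
  post Q p (hold_letter x1 ord0) (kernel_at (det_action hold_letter) (hold_letter x1 ord0))
  = prod_belief x1 (fun s => p x1 s / \sum_s p x1 s).
Proof.
have hE x (s : S) : (hold_letter x1 ord0 == hold_letter x s) = (x == x1).
  apply/eqP/eqP => [/(congr1 val)/=|->]; last by apply/val_inj; rewrite /= !hold_letterE.
  by rewrite !hold_letterE => e; apply/val_inj.
have mE : mass (kernel_at (det_action hold_letter) (hold_letter x1 ord0)) p
    = \sum_s p x1 s.
  rewrite /mass (bigD1 x1) //= [X in _ + X]big1 ?addr0 => [|x xn].
    by apply: eq_bigr => s _; rewrite /kernel_at /det_action hE eqxx mul1r.
  by apply: big1 => s _; rewrite /kernel_at /det_action hE (negbTE xn) mul0r.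
apply/funext => x'; apply/funext => s'; rewrite /post mE /prod_belief mulrA; congr (_ / _).
rewrite /push (bigD1 x1) //= [X in _ + X]big1 ?addr0 => [|x xn].
  rewrite (big_pred1 s') => [|s /=].
    by rewrite /kernel_at /det_action hE eqxx mulr1.
  by rewrite hold_letterE eqn_add2r.
by apply: big1 => s _; rewrite /kernel_at /det_action hE (negbTE xn) mulr0 mul0r.
Qed.

(** Buying exactly the demand restores the product form at the price [C]: the demand becomes known,
    and the charge conditioned on it stays put, hence in [K]. *)
Lemma hold_bound (K : S -> Prop) B : 0 <= B ->
  (forall x0 sg, is_pmf sg -> (forall s, sg s != 0 -> K s) ->
     v (prod_belief x0 sg) <= B) ->
  forall p, is_pmfXS p -> (forall x s, p x s != 0 -> K s) -> v p <= C + B.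
Proof.
move=> B0 H p pp pK; apply: (det_bound (d := hold_letter)) => //.
  exact: hold_feasible.
move=> y my0; have [x1 [s1]] := mass_gt0_exists my0.
rewrite /kernel_at /det_action; case: eqP => [e _|_]; last by rewrite mul0r ltxx.
have {e} e : y = hold_letter x1 ord0 by rewrite e.
have p0 := pp.1.
rewrite e post_hold; apply: H.
  split; last rewrite -mulr_suml divff //.
    by move=> s; rewrite divr_ge0 // sumr_ge0.
  apply/eqP => z; move: my0; rewrite /mass big1 ?ltxx // => x _.
  apply: big1 => s _; rewrite /kernel_at /det_action e.
  case: eqP => [/(congr1 val)/=|]; last by rewrite mul0r.
  rewrite !hold_letterE => /val_inj <-.
  by rewrite (psumr_eq0P (fun s _ => p0 x1 s) z) // mulr0.
by move=> s; rewrite mulf_eq0 negb_or => /andP[/pK].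
Qed.

(* Letters are grouped in pairs {2j, 2j+1}. Within its pair the letter carries the
   bit [g s b], [b] the parity of [x], so it discloses [x] up to parity only and
   the charge moves by [g s b - b]. A letter [x] without partner is held. *)
Definition pair_letter (g : S -> bool -> bool) (x : X) (s : S) : Y :=
  inord (if (x - odd x < my)%N then (x - odd x + g s (odd x))%N else x).

Definition pair_feasible (g : S -> bool -> bool) :=
  forall (s : S) (b : bool), ((b <= s + g s b) && (s + g s b <= ms + b))%N.

(** An even [mx] needs the partner [mx + 1], which is missing exactly when [my = mx]. *)
Definition solo (y : Y) := [&& y == mx :> nat, ~~ odd mx & my == mx].

Lemma odd_le n : (odd n <= n)%N. Proof. by case: n => //= n; case: odd. Qed.

Lemma pair_letterE g (x : X) (s : S) : pair_letter g x s =
  (if (x - odd x < my)%N then x - odd x + g s (odd x) else x)%N :> nat.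
Proof.
rewrite /pair_letter inordK //; have := odd_le x; have := ltn_ord x.
case: ifP => h; last by lia.
by case: (g _ _) => /=; lia.
Qed.

Lemma pair_letter_feasible g : pair_feasible g ->
  forall (x : X) (s : S), feasible ms s x (pair_letter g x s).
Proof.
move=> gf x s; rewrite /feasible pair_letterE; have := gf s (odd x).
have := odd_le x; have := ltn_ord s; case: ifP; lia.
Qed.

Lemma pair_letter_nonsolo g x s y : ~~ solo y -> y = pair_letter g x s ->
  y = (x - odd x + g s (odd x))%N :> nat.
Proof.
move=> ns e; have := congr1 val e; rewrite /= pair_letterE; case: ifP => // h ye.
move: ns; rewrite /solo ye; have := ltn_ord x; have := odd_le x; move: h.
case: (boolP (odd x)) => ox /=; first by lia.
move=> h _ xm; have xe : x = mx :> nat by lia.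
by rewrite xe eqxx /= -xe ox /=; lia.
Qed.

Lemma pair_post_support g x0 sg (y : Y) x' s' : ~~ solo y ->
  post Q (prod_belief x0 sg) y (kernel_at (det_action (pair_letter g)) y) x' s' != 0 ->
  exists (s : S) (b : bool), [/\ sg s != 0, g s b = odd y & (s + g s b = s' + b)%N].
Proof.
move=> ns /det_post_support[x [s [pn e se]]].
have ye := pair_letter_nonsolo ns e.
exists s, (odd x); split; first by move: pn; rewrite mulf_eq0 => /norP[].
  rewrite ye oddD oddB ?odd_le // oddb; by case: (odd x); case: (g _ _).
by move: se; rewrite ye; have := odd_le x; lia.
Qed.

Hypothesis Qmm : Q ord_max ord_max < 1.

Lemma post_solo g x0 sg (y : Y) : is_pmf sg -> solo y ->
  mass (kernel_at (det_action (pair_letter g)) y) (prod_belief x0 sg) = Q x0 ord_max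
  /\ (Q x0 ord_max != 0 ->
  post Q (prod_belief x0 sg) y (kernel_at (det_action (pair_letter g)) y)
    = prod_belief ord_max sg).
Proof.
move=> [sg0 sg1] /and3P[/eqP ye nom /eqP emy].
have hE x (s : S) : (y == pair_letter g x s) = (x == ord_max).
  apply/eqP/eqP => [/(congr1 val)/=|->]; last first.
    apply/val_inj; rewrite /= pair_letterE /= (negbTE nom) ye; case: ifP => //; lia.
  rewrite pair_letterE ye => e; apply/val_inj => /=; move: e.
  case: ifP => // h e; exfalso; have := ltn_ord x; have := odd_le x.
  move: h e nom; case: (boolP (odd x)) => ox /=; case: (g _ _) => /=; last 2 first.
  - by move=> *; lia.
  - by move=> *; lia.
  - by move=> *; lia.
  by move=> *; lia.
have mE : mass (kernel_at (det_action (pair_letter g)) y) (prod_belief x0 sg) = Q x0 ord_max.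
  rewrite /mass (bigD1 ord_max) //= [X in _ + X]big1 ?addr0 => [|x xn].
    under eq_bigr => s _ do rewrite /kernel_at /det_action hE eqxx mul1r /prod_belief.
    by rewrite -mulr_sumr sg1 mulr1.
  by apply: big1 => s _; rewrite /kernel_at /det_action hE (negbTE xn) mul0r.
split=> // qn; apply/funext => x'; apply/funext => s'; rewrite /post mE /prod_belief.
rewrite /push (bigD1 ord_max) //= [X in _ + X]big1 ?addr0 => [|x xn].
  rewrite (big_pred1 s') => [|s /=].
    by rewrite /kernel_at /det_action hE eqxx mulr1; field.
  by rewrite ye eqn_add2r.
by apply: big1 => s _; rewrite /kernel_at /det_action hE (negbTE xn) mulr0 mul0r.
Qed.

(** The solo letter fails to disclose anything about the charge, but it only sends
    [prod_belief x0 sg] to [prod_belief ord_max sg]. With [w x] the value at [prod_belief x sg] this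
    gives [w x <= C + B + Q x ord_max * w ord_max]; solving at [x = ord_max] yields the geometric
    factor [1 / (1 - Q ord_max ord_max)]. *)
Lemma pair_bound g sg B : pair_feasible g -> is_pmf sg -> 0 <= B ->
  (forall x0 y, ~~ solo y ->
     0 < mass (kernel_at (det_action (pair_letter g)) y) (prod_belief x0 sg) ->
     v (post Q (prod_belief x0 sg) y (kernel_at (det_action (pair_letter g)) y)) <= B) ->
  forall x0, v (prod_belief x0 sg) <= C + B + (C + B) / (1 - Q ord_max ord_max).
Proof.
move=> gf sgp B0 H x0; set V := _ / _.
have CB0 : 0 <= C + B by rewrite addr_ge0.
have V0 : 0 <= V by rewrite divr_ge0 // subr_ge0 ltW.
have df := pair_letter_feasible gf.
have da := det_action_admissible df.
case: (boolP (~~ odd mx && (my == mx))) => [/andP[nom /eqP em]|nsolo]; last first.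
  apply: (@le_trans _ _ (C + B)); last by rewrite lerDl.
  apply: det_bound => //; first exact: pmf_prod_belief.
  move=> y; apply: H; rewrite /solo negb_and nsolo orbT //.
pose ys : Y := inord mx.
have yss : solo ys by rewrite /solo inordK ?eqxx ?nom ?em ?eqxx //; lia.
have step x1 : v (prod_belief x1 sg) <= C + B + Q x1 ord_max * v (prod_belief ord_max sg).
  have pp := pmf_prod_belief x1 sgp.
  apply: (le_trans (vB pp da)); rewrite -addrA lerD2l (bigD1 ys) //= addrC; apply: lerD.
    apply: (@le_trans _ _ (\sum_(y | y != ys)
      mass (kernel_at (det_action (pair_letter g)) y) (prod_belief x1 sg) * B)).
      apply: ler_sum => y yn.
      have m0 : 0 <= mass (kernel_at (det_action (pair_letter g)) y) (prod_belief x1 sg).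
        by case: pp => p0 _; apply: mass_ge0 => // x s; rewrite /kernel_at /det_action ler0n.
      have [->|mn] := eqVneq (mass (kernel_at (det_action (pair_letter g)) y) (prod_belief x1 sg)) 0.
        by rewrite !mul0r.
      rewrite ler_wpM2l // H ?lt0r ?mn //.
      apply: contra yn => /and3P[/eqP ye _ _]; apply/eqP/val_inj.
      by rewrite /= inordK //; lia.
    rewrite -mulr_suml -[leRHS]mul1r ler_wpM2r //.
    rewrite -(sum_mass da pp) [leRHS](bigD1 ys) //= lerDr.
    by case: pp => p0 _; apply: mass_ge0 => // x s; rewrite /kernel_at /det_action ler0n.
  have [me pe] := post_solo g x1 sgp yss; rewrite me.
  have [->|/pe->] := eqVneq (Q x1 ord_max) 0; by rewrite ?mul0r.
have vm : v (prod_belief ord_max sg) <= V.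
  rewrite ler_pdivlMr ?subr_gt0 //; have := step ord_max.
  set w := v _; set q := Q _ _; lra.
apply: (le_trans (step x0)); rewrite lerD2l.
apply: (le_trans (ler_wpM2l (sto_ge0 stoQ _ _) vm)).
by rewrite ler_piMl // sto_le1.
Qed.

Lemma pair_bound_ge0 B : 0 <= B -> 0 <= C + B + (C + B) / (1 - Q ord_max ord_max).
Proof.
move=> B0; have CB0 : 0 <= C + B by rewrite addr_ge0.
by apply: addr_ge0 => //; rewrite divr_ge0 // subr_ge0 ltW.
Qed.

(** The bound is uniform in the position [a] and in the law [sg], which is what the induction on the
    length of the interval requires. *)
Definition interval_bound L := exists2 B, 0 <= B &
  forall a x0 sg, is_pmf sg -> (forall s : S, sg s != 0 -> (a <= s <= a + L)%N) ->
    v (prod_belief x0 sg) <= B.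

Definition query (a : nat) (s : S) (_ : bool) : bool := (s <= a)%N.

Lemma query_feasible a : (a < ms)%N -> pair_feasible (query a).
Proof. by move=> am s b; rewrite /query; have := ltn_ord s; case: leqP; case: b => /=; lia. Qed.

Definition flip (j : nat) (s : S) (b : bool) : bool := if s == j :> nat then ~~ b else b.

Lemma flip_feasible j : (0 < j < ms)%N -> pair_feasible (flip j).
Proof. by move=> jm s b; rewrite /flip; have := ltn_ord s; case: eqP; case: b => /=; lia. Qed.

Definition point (s0 : S) : S -> R := fun s => (s == s0)%:R.

(* The query letter tells the two candidate charges apart, so the posterior does
   not depend on their weights. *)
Lemma interval_bound1 : interval_bound 1.
Proof.
have [B1 B10 H1] := @finite_upper_bound R (X * S * S * Y)%type (fun i =>
  v (post Q (prod_belief i.1.1.1 (point i.1.1.2)) i.2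
       (kernel_at (det_action (pair_letter (query i.1.2))) i.2))).
have [B2 B20 H2] := @finite_upper_bound R (X * S)%type (fun i =>
  v (prod_belief i.1 (point i.2))).
pose B := C + B1 + (C + B1) / (1 - Q ord_max ord_max).
have B0 : 0 <= B by exact: pair_bound_ge0.
exists (B + B2); first exact: addr_ge0.
move=> a x0 sg [sg0 sg1] sup; case: (ltnP a ms) => am; last first.
  have -> : sg = point ord_max.
    have z s : s != ord_max -> sg s = 0.
      move=> sn; apply/eqP; apply: contraNT sn => /sup h; apply/eqP/val_inj => /=.
      by have := ltn_ord s; lia.
    apply/funext => s; rewrite /point; case: eqP => [->|/eqP/z//].
    by rewrite -sg1 (bigD1 ord_max) //= big1 ?addr0.
  by apply: (le_trans (H2 (x0, ord_max))); rewrite lerDr.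
apply: (@le_trans _ _ B); last by rewrite lerDl.
apply: (pair_bound (query_feasible am)) => // x1 y ns m0.
(* The charge singled out by the observed bit, which is the parity of [y]. Its probability [sg s0]
   is a common factor that the normalization removes. *)
pose s0 : S := inord (if odd y then a else a.+1).
have s0E : s0 = (if odd y then a else a.+1) :> nat by rewrite inordK //; case: ifP; lia.
have key x s : kernel_at (det_action (pair_letter (query a))) y x s * prod_belief x1 sg x s =
    sg s0 * (kernel_at (det_action (pair_letter (query a))) y x s
             * prod_belief x1 (point s0) x s).
  rewrite {1 2}/kernel_at /det_action; case: eqP => [e|]; last by rewrite !mul0r mulr0.
  have ye := pair_letter_nonsolo ns e.
  have go : query a s (odd x) = odd y.
    by rewrite ye oddD oddB ?odd_le // oddb; case: (odd x); case: (query _ _ _).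
  rewrite !mul1r /prod_belief /point; case: eqP => [->|sn]; first by rewrite mulr1 mulrC.
  suff -> : sg s = 0 by rewrite !mulr0.
  apply/eqP; apply: contrapT => /negP/sup h; apply: sn; apply/val_inj => /=.
  by rewrite s0E (query_determined h go).
have sn : sg s0 != 0.
  by apply/eqP => z; move: m0; rewrite (mass_scale key) z mul0r ltxx.
rewrite (post_ext _ _ sn key).
by have := H1 (x1, s0, inord a, y); rewrite /= inordK //; lia.
Qed.

(* Flipping at [a+1] empties that charge: it moves to [a] or to [a+2]. The query at
   [a] then leaves the charge in [a, a+1] or in [a+1, a+L+2]. *)
Lemma interval_boundS L : interval_bound L.+1 -> interval_bound L.+2.
Proof.
move=> [B1 B10 H1]; have [B2 B20 H2] := interval_bound1.
pose W B := C + B + (C + B) / (1 - Q ord_max ord_max).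
have W0 B : 0 <= B -> 0 <= W B by exact: pair_bound_ge0.
pose B3 := W (C + (B1 + B2)).
have B30 : 0 <= B3 by apply: W0; rewrite !addr_ge0.
have B40 : 0 <= W (C + B3) by apply: W0; rewrite addr_ge0.
exists (W (C + B3) + B2); first by rewrite addr_ge0.
(* If [a + 1 >= ms], at most two charges remain and the base case applies. *)
move=> a x0 sg sgp sup; case: (ltnP a.+1 ms) => am; last first.
  apply: (@le_trans _ _ B2); last by rewrite lerDr.
  by apply: (H2 a) => // s /sup; have := ltn_ord s; lia.
apply: (@le_trans _ _ (W (C + B3))); last by rewrite lerDl.
have fam : (0 < a.+1 < ms)%N by lia.
have qam : (a < ms)%N by lia.
apply: (pair_bound (flip_feasible fam)) => //; first by rewrite addr_ge0.
move=> x1 y ns m0.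
(* The flip correlates demand and charge; a hold brings back a product belief before the query. *)
apply: (hold_bound (K := fun s : S => (a <= s <= a + L.+2)%N /\ s <> a.+1 :> nat)) => //.
- move=> x2 sg2 sg2p sup2.
  apply: (pair_bound (query_feasible qam)) => //; first by rewrite !addr_ge0.
  move=> x3 y3 ns3 m03.
  have pp3 : is_pmfXS (post Q (prod_belief x3 sg2) y3
       (kernel_at (det_action (pair_letter (query a))) y3)).
    apply: pmf_post => //; last exact: pmf_prod_belief.
    move=> x s; rewrite /kernel_at /det_action; case: (y3 =P pair_letter _ x s) => [-> _|_]; last by rewrite eqxx.
    exact: (pair_letter_feasible (query_feasible qam)).
  case: (boolP (odd y3)) => oy.
    apply: (@le_trans _ _ (C + B2)); last by rewrite lerD2l lerDr.
    apply: (hold_bound (K := fun s : S => (a <= s <= a + 1)%N)) => //; first exact: H2.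
    move=> x s /(pair_post_support ns3)[t [b [tn go se]]].
    by have [h1 h2] := sup2 t tn; rewrite oy in go; exact: (query_true_range h1 go se).
  apply: (@le_trans _ _ (C + B1)); last by rewrite lerD2l lerDl.
  apply: (hold_bound (K := fun s : S => (a.+1 <= s <= a.+1 + L.+1)%N)) => //; first exact: H1.
  move=> x s /(pair_post_support ns3)[t [b [tn go se]]].
  have [h1 h2] := sup2 t tn; rewrite (negbTE oy) in go.
  exact: (query_false_range h1 h2 go se).
- apply: pmf_post => //; last exact: pmf_prod_belief.
  move=> x s; rewrite /kernel_at /det_action; case: (y =P pair_letter _ x s) => [-> _|_]; last by rewrite eqxx.
  exact: (pair_letter_feasible (flip_feasible fam)).
- move=> x s /(pair_post_support ns)[t [b [tn go se]]].
  exact: (flip_range (sup t tn) se).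
Qed.

Lemma value_upper_bound : exists2 B, 0 <= B & forall p, is_pmfXS p -> v p <= B.
Proof.
have HL L : interval_bound L.+1.
  by elim: L => [|L IH]; [exact: interval_bound1 | exact: interval_boundS].
have [B B0 H] := HL ms.
exists (C + B); first exact: addr_ge0.
move=> p pp; apply: (hold_bound (K := fun _ => True)) => // x0 sg sgp _.
by apply: (H 0%N) => // s _; have := ltn_ord s; lia.
Qed.

End UpperBound.

(** * Lower bound on the value function *)

Section Reach.
Variables (R : realType) (mx my ms : nat) (Q : 'M[R]_mx.+1).
Local Notation X := 'I_mx.+1.
Local Notation Y := 'I_my.+1.
Local Notation S := 'I_ms.+1.

(* [h x s] is the probability of the letter [y] in state [(x, s)] under some
   admissible action. *)
Definition valid_weight (y : Y) (h : X -> S -> R) :=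
  forall (x : X) (s : S), [/\ 0 <= h x s, h x s <= 1,
    (h x s != 0 -> feasible ms s x y) &
    (h x s != 1 -> exists2 y' : Y, y' != y & feasible ms s x y')].

(** One letter isolated in the optimality inequality, the others being absorbed in [K]. It turns a
    lower bound at [p] into one at a posterior reached with probability bounded away from 0. *)
Definition reach_bound (v : (X -> S -> R) -> R) (K : R) :=
  forall p y h, is_pmfXS p -> valid_weight y h -> 0 < mass h p ->
  v p - K <= mass h p * v (post Q p y h).

Lemma valid_weight_kernel a y : admissible a -> valid_weight y (kernel_at a y).
Proof.
move=> aa x s; rewrite /kernel_at; have [a0 [a1 _]] := aa x s; split => //.
- by rewrite -a1 (bigD1 y) //= lerDl sumr_ge0.
- exact: admissible_feasible.
move=> an; apply: contrapT => nE; move/eqP: an; apply.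
rewrite -a1 (bigD1 y) //= big1 ?addr0 // => y' yn; apply/eqP; apply: contrapT => /negP an.
by apply: nE; exists y' => //; exact: (admissible_feasible aa an).
Qed.

(** The missing mass [1 - h] goes to a single alternative letter [alt], which the last clause of
    [valid_weight] supplies wherever [h] differs from 1. *)
Lemma valid_weight_extend y h : valid_weight y h ->
  exists2 a : X -> S -> Y -> R, admissible a & kernel_at a y = h.
Proof.
move=> hv.
pose alt (x : X) (s : S) : Y :=
  if [pick y' : Y | (y' != y) && feasible ms s x y'] is Some y' then y' else y.
pose a (x : X) (s : S) (y' : Y) : R :=
  if y' == y then h x s else if y' == alt x s then 1 - h x s else 0.
have altP (x : X) (s : S) : h x s != 1 -> (alt x s != y) && feasible ms s x (alt x s).
  case: (hv x s) => _ _ _ H /H[y' yn yf]; rewrite /alt; case: pickP => [//|].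
  by move=> /(_ y'); rewrite yn yf.
exists a; last by apply/funext => x; apply/funext => s; rewrite /kernel_at /a eqxx.
move=> x s; have [h0 h1 hf _] := hv x s; split.
  by move=> y'; rewrite /a; case: ifP => // _; case: ifP => // _; rewrite subr_ge0.
have [e1|n1] := eqVneq (h x s) 1.
  have aE y' : a x s y' = if y' == y then 1 else 0.
    by rewrite /a e1 subrr; case: ifP => // _; case: ifP.
  have fy : feasible ms s x y by apply: hf; rewrite e1 oner_neq0.
  have s2 (P : pred Y) : P y -> \sum_(y' | P y') a x s y' = 1.
    move=> Py; rewrite (bigD1 y) //= aE eqxx big1 ?addr0 // => y' /andP[_ /negbTE e].
    by rewrite aE e.
  by split; apply: s2.
have /andP[an af] := altP x s n1.
have s1 (P : pred Y) : P (alt x s) -> (h x s != 0 -> P y) ->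
    \sum_(y' | P y') a x s y' = 1.
  move=> Pa Py; rewrite (bigD1 (alt x s)) //= /a (negbTE an) eqxx.
  have [h00|hn] := eqVneq (h x s) 0.
    rewrite h00 subr0 big1 ?addr0 // => y' /andP[_ yn].
    by case: ifP => // _; rewrite (negbTE yn).
  rewrite (bigD1 y) /=; last by rewrite Py // eq_sym.
  rewrite eqxx big1 ?addr0 ?subrK // => y' /andP[/andP[_ yn] yn2].
  by rewrite (negbTE yn2) (negbTE yn).
by split; apply: s1.
Qed.

Lemma reach_bound_from_upper (v : (X -> S -> R) -> R) C B :
  0 <= B -> stochastic Q ->
  (forall p (a : X -> S -> Y -> R), is_pmfXS p -> admissible a ->
    v p <= C + \sum_y mass (kernel_at a y) p * v (post Q p y (kernel_at a y))) ->
  (forall p, is_pmfXS p -> v p <= B) ->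
  reach_bound v (C + B).
Proof.
move=> B0 stoQ vB UB p y h pp hv m0.
have [a aa ae] := valid_weight_extend hv.
have a0 y' x s : 0 <= kernel_at a y' x s by rewrite /kernel_at; case: (aa x s).
have H := vB p a pp aa.
rewrite (bigD1 y) //= ae in H.
suff : \sum_(y' | y' != y) mass (kernel_at a y') p * v (post Q p y' (kernel_at a y')) <= B.
  by move: H; set A := mass h p * _; set T := \sum_(_ | _) _ ; lra.
apply: (@le_trans _ _ (\sum_(y' | y' != y) mass (kernel_at a y') p * B)).
  apply: ler_sum => y' _.
  have m0' : 0 <= mass (kernel_at a y') p by apply: mass_ge0 => //; case: pp.
  have [->|mn] := eqVneq (mass (kernel_at a y') p) 0; first by rewrite !mul0r.
  rewrite ler_wpM2l // UB //; apply: pmf_post => //; last by rewrite lt0r mn.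
  by move=> x s; apply: (admissible_feasible aa).
rewrite -mulr_suml ler_piMl //.
rewrite -(sum_mass aa pp) [leRHS](bigD1 y) //= lerDr; apply: mass_ge0 => //; by case: pp.
Qed.

(** The weights are arbitrary at each step, so the set does not refer to the minimizing policy. *)
Inductive reachable (p1 : X -> S -> R) : (X -> S -> R) -> Prop :=
| reachable_start : reachable p1 p1
| reachable_step p y h : reachable p1 p -> valid_weight y h -> 0 < mass h p ->
    reachable p1 (post Q p y h).

Lemma reachable_pmf p1 p : stochastic Q -> is_pmfXS p1 -> reachable p1 p -> is_pmfXS p.
Proof.
move=> stoQ pp1; elim=> // {}p y h _ pp hv m0; apply: pmf_post => //.
  by move=> x s; case: (hv x s).
by move=> x s; case: (hv x s).
Qed.

End Reach.

(* Real-valued hypotheses make [lia] very slow, so they are cleared first. *)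
Ltac natlia :=
  repeat match goal with
  | H : context [@Order.le] |- _ => clear H
  | H : context [@Order.lt] |- _ => clear H
  | H : context [@GRing.zero] |- _ => clear H
  | H : context [@GRing.one] |- _ => clear H
  | H : context [@valid_weight] |- _ => clear H
  | H : context [@reach_bound] |- _ => clear H
  | H : context [@is_pmfXS] |- _ => clear H
  | H : context [@stochastic] |- _ => clear H
  | H := _ |- _ => clear H
  end; lia.

Lemma oppr_norm_le (R : realType) (x : R) : - `|x| <= x.
Proof. by rewrite lerNl -normrN ler_norm. Qed.

Lemma positive_entries_lower_bound (R : realType) n (Q : 'M[R]_n.+1) :
  stochastic Q -> exists q0 : R, [/\ 0 < q0, q0 <= 1 & forall i j, Q i j != 0 -> q0 <= Q i j].
Proof.
move=> stoQ; pose F (ij : 'I_n.+1 * 'I_n.+1) := if Q ij.1 ij.2 == 0 then 1 else Q ij.1 ij.2.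
have F0 ij : 0 < F ij.
  by rewrite /F; case: ifP => // /negbT qn; rewrite lt0r qn sto_ge0.
have F1 ij : F ij <= 1 by rewrite /F; case: ifP => // _; rewrite sto_le1.
(* All factors are at most 1, so the product lies below each positive entry and replaces a
   minimum. *)
exists (\prod_ij F ij); split; first by apply: prodr_gt0.
  by apply: prodr_ile1 => ij; rewrite F1 ltW.
move=> i j qn; rewrite (bigD1 (i, j)) //= {1}/F /= (negbTE qn) ler_piMr ?sto_ge0 //.
by apply: prodr_ile1 => ij; rewrite F1 ltW.
Qed.

(** * Steering a belief to a prescribed posterior *)

Section LowerBound.
Variables (R : realType) (mx my ms : nat) (Q : 'M[R]_mx.+1).
Local Notation X := 'I_mx.+1.
Local Notation Y := 'I_my.+1.
Local Notation S := 'I_ms.+1.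
Implicit Types (b p h : X -> S -> R) (u x : X) (s : S) (y z : Y) (B : R).
Variables (v : (X -> S -> R) -> R) (K : R).
Hypotheses (stoQ : stochastic Q) (mx_gt0 : (0 < mx)%N) (le_mx_my : (mx <= my)%N)
  (ms_gt0 : (0 < ms)%N) (K_ge0 : 0 <= K).
Hypothesis reach : @reach_bound R mx my ms Q v K.

(** A letter other than the demand can be replaced by holding. For [y = x] the candidates are
    [x - 1] and [x + 1], and both fail only at the two excluded corners. *)
Lemma other_letter (x : X) (s : S) (y : Y) :
  ~ [/\ y = 0%N :> nat, x = 0%N :> nat & s = ms :> nat] ->
  ~ [/\ y = my :> nat, x = my :> nat & s = 0%N :> nat] ->
  exists2 y' : Y, y' != y & feasible ms s x y'.
Proof.
move=> c1 c2; have xm := ltn_ord x; have sm := ltn_ord s.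
have [yx|/eqP yx] := eqVneq (y : nat) x; last first.
  exists (inord x); rewrite /feasible ?inordK; try natlia.
  by apply/eqP => /(congr1 val) /=; rewrite inordK; natlia.
case: (boolP ((0 < x) && (0 < s))%N) => [xs|nxs].
  exists (inord x.-1); rewrite /feasible ?inordK; try natlia.
  by apply/eqP => /(congr1 val) /=; rewrite inordK; natlia.
case: (boolP ((x < my) && (s < ms))%N) => [xs|nxs2].
  exists (inord x.+1); rewrite /feasible ?inordK; try natlia.
  by apply/eqP => /(congr1 val) /=; rewrite inordK; natlia.
exfalso; case: (posnP x) => x0; first by apply: c1; split; natlia.
by apply: c2; split; natlia.
Qed.

Let n : R := (mx.+1 * ms.+1)%:R.

Let n_gt0 : 0 < n. Proof. by rewrite ltr0n. Qed.

Let unif : X -> S -> R := fun _ _ => n^-1.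

Lemma unif_pmf : is_pmfXS unif.
Proof.
split=> [x s|]; first by rewrite invr_ge0 ltW.
under eq_bigr => x _ do rewrite sumr_const card_ord.
rewrite sumr_const card_ord -mulrnA -mulr_natl mulnC; apply: divff; exact: lt0r_neq0.
Qed.

Lemma post_value_ge p (y : Y) h B d : is_pmfXS p -> valid_weight y h -> 0 <= B ->
  - B <= v p -> 0 < d -> d <= mass h p -> - ((B + K) / d) <= v (post Q p y h).
Proof.
move=> pp hv B0 vp d0 dm; have m0 : 0 < mass h p by apply: lt_le_trans dm.
have := reach pp hv m0; set w := v (post _ _ _ _) => H.
have BK : 0 <= B + K by rewrite addr_ge0.
rewrite -mulNr ler_pdivrMr //.
have {H} H : - (B + K) <= mass h p * w by move: H vp; lra.
have [w0|w0] := leP 0 w; first by rewrite (@le_trans _ _ 0) ?oppr_le0 // mulr_ge0 // ltW.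
apply: (le_trans H); rewrite mulrC ler_wnM2l // ltW //.
Qed.

(** Such a letter is never forced, so the weights [h * p / mass h p], all at most 1, are valid. From
    the uniform belief they produce the same posterior, with probability [1 / n]. *)
Lemma noncorner_value_ge : exists2 B, 0 <= B & forall p (y : Y) h, is_pmfXS p ->
  valid_weight y h -> 0 < mass h p -> y != 0%N :> nat -> ~~ ((y == my :> nat) && (mx == my)) ->
  - B <= v (post Q p y h).
Proof.
exists ((`|v unif| + K) / n^-1); first by rewrite divr_ge0 ?addr_ge0 ?invr_ge0 // ltW.
move=> p y h pp hv m0 y0 ym.
have h0 x s : 0 <= h x s by case: (hv x s).
have p0 := pp.1.
pose h' x s := h x s * p x s / mass h p.
have key x s : h' x s * unif x s = (mass h p * n)^-1 * (h x s * p x s).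
  rewrite /h' /unif invfM; ring.
have kn : (mass h p * n)^-1 != 0 by rewrite invr_eq0 mulf_neq0 ?gt_eqF.
rewrite -(post_ext Q y kn key); apply: post_value_ge => //.
- exact: unif_pmf.
- move=> x s; split.
  + by rewrite divr_ge0 // ?mulr_ge0 // ltW.
  + by rewrite ler_pdivrMr // mul1r mass_ge_term.
  + by rewrite /h' !mulf_eq0 !negb_or => /andP[/andP[hn _] _]; case: (hv x s) => _ _ /(_ hn).
  + move=> _; apply: other_letter => -[e1 e2 e3]; first by rewrite e1 in y0.
    by move: ym; rewrite e1 eqxx /=; have := ltn_ord x; lia.
- exact: oppr_norm_le.
- by rewrite invr_gt0.
- by rewrite (mass_scale key) invfM mulrAC mulVf ?mul1r // gt_eqF.
Qed.

Definition letter0 : Y := ord0.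

Variable q0 : R.
Hypotheses (q0_gt0 : 0 < q0) (q0_le1 : q0 <= 1) (q0P : forall i j, Q i j != 0 -> q0 <= Q i j).

Lemma valid_weight0 b : (forall x s, 0 <= b x s) -> (forall x s, b x s <= 1) ->
  (forall (x : X) (s : S), b x s != 0 -> (x <= s)%N) -> b ord0 ord_max = 1 ->
  valid_weight letter0 b.
Proof.
move=> b0 b1 bf bm x s; split=> //.
  by move=> /bf h; rewrite /feasible /=; have := ltn_ord s; lia.
move=> bn; apply: other_letter => -[/= e1 e2 e3]; last by lia.
move/eqP: bn; apply; rewrite -bm; congr (b _ _); exact: val_inj.
Qed.

Lemma valid_weight0_corner b : valid_weight letter0 b -> b ord0 ord_max = 1.
Proof.
move=> /(_ ord0 ord_max)[_ _ _ H]; apply/eqP; apply: contrapT => /negP/H[y' yn].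
by rewrite /feasible /=; move: yn; rewrite -val_eqE /=; lia.
Qed.

Lemma valid_weight0_le b x s : valid_weight letter0 b -> b x s != 0 -> (x <= s)%N.
Proof. by move=> /(_ x s)[_ _ H _] /H; rewrite /feasible /=; lia. Qed.

(* In the corner state [(0, ms)] the letter 0 is forced, so a belief [q] can be
   steered to the posterior of [p] under the letter 0 with weights [b] exactly when
   it dominates a multiple of [b * p], with equality at the corner.
   The weights are restricted to those that still allow [j] further letters 0 from
   states with nonzero demand. *)
Definition dominated (j : nat) (B : R) (p : X -> S -> R) :=
  forall b, valid_weight letter0 b ->
  (forall (x : X) (s : S), b x s != 0 -> (0 < x)%N -> (x + j <= s)%N) ->
  0 < mass b p ->
  exists q c, [/\ is_pmfXS q, B^-1 <= c, - B <= v q,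
    (forall x s, c * (b x s * p x s) <= mass b p * q x s) &
    c * p ord0 ord_max = mass b p * q ord0 ord_max].

Lemma dominated_mono j B B' p : 0 < B -> B <= B' -> dominated j B p -> dominated j B' p.
Proof.
move=> B0 BB H b bv bj m0; have [q [c [qp cB vq le_q eq_q]]] := H b bv bj m0.
exists q, c; split=> //; last by apply: le_trans vq; rewrite lerN2.
by apply: le_trans cB; rewrite lef_pV2 // posrE // (lt_le_trans B0).
Qed.

Lemma dominated0 j B p : dominated 0 B p -> dominated j B p.
Proof.
move=> H b bv _; apply: H => // x s /(valid_weight0_le bv); lia.
Qed.

Lemma dominated_value j B p b : 0 < B -> is_pmfXS p -> dominated j B p ->
  valid_weight letter0 b ->
  (forall (x : X) (s : S), b x s != 0 -> (0 < x)%N -> (x + j <= s)%N) ->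
  0 < mass b p -> - ((B + K) * B) <= v (post Q p letter0 b).
Proof.
move=> B0 pp H bv bj m0; have [q [c [qp cB vq le_q eq_q]]] := H b bv bj m0.
have c0 : 0 < c by apply: lt_le_trans cB; rewrite invr_gt0.
have b0 x s : 0 <= b x s by case: (bv x s).
have bp0 x s : 0 <= b x s * p x s by rewrite mulr_ge0 // (pp.1 x s).
(* Where [q] vanishes the weight does not affect the posterior, but validity still asks for 1 at the
   corner, where the letter 0 is forced. *)
pose h x s := if q x s == 0 then ((x == ord0) && (s == ord_max))%:R
  else c * (b x s * p x s) / (mass b p * q x s).
have key x s : h x s * q x s = c / mass b p * (b x s * p x s).
  rewrite /h; have [e|qn] := eqVneq (q x s) 0.
    have := le_q x s; rewrite e !mulr0 pmulr_rle0 // => bp.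
    have -> : b x s * p x s = 0 by apply/le_anti; rewrite bp bp0.
    by rewrite !mulr0.
  by field; rewrite qn gt_eqF.
have mE : mass h q = c by rewrite (mass_scale key) divfK // gt_eqF.
have kn : c / mass b p != 0 by rewrite mulf_neq0 ?invr_eq0 ?gt_eqF.
rewrite -(post_ext Q letter0 kn key).
apply: (@le_trans _ _ (- ((B + K) / c))).
  rewrite lerN2 ler_wpM2l ?addr_ge0 //; first exact: ltW.
  by rewrite invf_ple ?posrE.
apply: post_value_ge => //; last by rewrite mE.
  apply: valid_weight0 => [x s|x s|x s|]; rewrite /h.
  - case: ifP => // _; apply: divr_ge0; first by rewrite mulr_ge0 // ltW.
    by apply: mulr_ge0; [exact: ltW | case: qp].
  - case: ifP => [_|/negbT qn]; first by case: (_ && _).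
    have q0' : 0 < q x s by rewrite lt0r qn; case: qp => ->.
    by rewrite ler_pdivrMr ?mulr_gt0 // mul1r le_q.
  - case: ifP => [_|_].
      by case: (boolP ((x == ord0) && _)) => [/andP[/eqP-> _]|_] //; rewrite eqxx.
    rewrite !mulf_eq0 !negb_or => /andP[/andP[_ /andP[bn _]] _].
    exact: (valid_weight0_le bv bn).
  - case: ifP => [_|/negbT qn]; first by rewrite !eqxx.
    rewrite (valid_weight0_corner bv) mul1r eq_q divff // mulf_neq0 // gt_eqF //.
exact: ltW.
Qed.

(** If [p1] charges the corner, [q = p1] works with [c = mass b p1], which is at least the corner
    weight because [b] is 1 there. Otherwise [q] is uniform off the corner. *)
Lemma start_dominated p1 : is_pmfXS p1 -> exists2 B, 0 < B & dominated 0 B p1.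
Proof.
move=> pp; have p0 := pp.1.
have [e|pn] := eqVneq (p1 ord0 ord_max) 0; last first.
  have pc : 0 < p1 ord0 ord_max by rewrite lt0r pn p0.
  exists (`|v p1| + (p1 ord0 ord_max)^-1); first by rewrite ltr_wpDl ?invr_gt0.
  move=> b bv _ m0; exists p1, (mass b p1).
  have b0 x s : 0 <= b x s by case: (bv x s).
  split=> //.
  - apply: (@le_trans _ _ (p1 ord0 ord_max)).
      rewrite -[leRHS]invrK lef_pV2 ?posrE ?invr_gt0 // ?lerDr //.
      by rewrite ltr_wpDl ?invr_gt0.
    rewrite -[leLHS]mul1r -(valid_weight0_corner bv); exact: mass_ge_term.
  - by apply: le_trans (oppr_norm_le _); rewrite lerN2 lerDl invr_ge0 ltW.
  - move=> x s; rewrite ler_wpM2l ?(ltW m0) // ler_piMl //; by case: (bv x s).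
pose m : R := (mx.+1 * ms.+1)%:R - 1.
have m_gt0 : 0 < m.
  by rewrite subr_gt0 -[ltLHS]/(1%:R) ltr_nat; nia.
pose q (x : X) (s : S) : R := if (x == ord0) && (s == ord_max) then 0 else m^-1.
have qp : is_pmfXS q.
  split=> [x s|]; first by rewrite /q; case: ifP => // _; rewrite invr_ge0 ltW.
  have -> : \sum_x \sum_s q x s = \sum_(x : X) \sum_(s : S) m^-1 - m^-1.
    have E : \sum_(s : S) m^-1 = m^-1 + \sum_(s : S | s != ord_max) m^-1.
      by rewrite (bigD1 ord_max).
    rewrite (bigD1 ord0) //= [in RHS](bigD1 ord0) //= (bigD1 ord_max) //=.
    rewrite {1}/q !eqxx /= add0r.
    rewrite [X in X + _](_ : _ = \sum_(i < ms.+1 | i != ord_max) m^-1); last first.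
      by apply: eq_bigr => s /negbTE sn; rewrite /q eqxx sn.
    rewrite [X in _ + X](_ : _ = \sum_(i < mx.+1 | i != ord0) \sum_(s : S) m^-1); last first.
      by apply: eq_bigr => x /negbTE xn; apply: eq_bigr => s _; rewrite /q xn.
    by rewrite E; ring.
  under eq_bigr => x _ do rewrite sumr_const card_ord.
  rewrite sumr_const card_ord -mulrnA -mulr_natl mulnC -[X in _ - X]mul1r -mulrBl.
  by apply: divff; rewrite gt_eqF.
exists (`|v q| + m); first by rewrite ltr_wpDl.
move=> b bv _ m0; exists q, m^-1; split=> //.
- rewrite lef_pV2 ?posrE ?lerDr //; exact: ltr_wpDl.
- by apply: le_trans (oppr_norm_le _); rewrite lerN2 lerDl ltW.
- have b0 x s : 0 <= b x s by case: (bv x s).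
  move=> x s; rewrite /q; case: ifP => [/andP[/eqP-> /eqP->]|_].
    by rewrite e !mulr0.
  by rewrite mulrC ler_wpM2r ?invr_ge0 ?(ltW m_gt0) // mass_ge_term.
- by rewrite e /q !eqxx !mulr0.
Qed.

Definition feeds (z : Y) (u : X) (s : S) := [exists s0 : S, (s0 + z == s + u)%N].

(** From the uniform belief the steering letter has probability at least [q0 / n], hence the value
    bound [(|v unif| + K) * (n / q0)]. The [+ 1] makes the constant at least [n / q0], as the bound
    on [c] requires. *)
Let steer_const : R := (`|v unif| + K + 1) * (n / q0).

Lemma steer_const_gt0 : 0 < steer_const.
Proof. by rewrite mulr_gt0 ?divr_gt0 // ltr_wpDl ?addr_ge0. Qed.

(* From the uniform belief one letter [z != 0], which is not forced at charges leading
   to [ms], reaches a belief whose weight at the corner is prescribed: the weights [tau]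
   are used on the transitions into charge [ms] that can feed the corner, all other
   transitions have full weight. *)
Lemma steer_dominated p b (z : Y) (tau : X -> R) : (forall x s, 0 <= p x s) ->
  valid_weight letter0 b -> 0 < mass b p -> z != 0%N :> nat ->
  (forall u, 0 <= tau u) ->
  (forall u, tau u != 0 -> Q u ord0 != 0 /\ feeds z u ord_max) ->
  \sum_u tau u * Q u ord0 = p ord0 ord_max ->
  (forall x s, b x s * p x s != 0 -> s != ord_max -> exists2 u, Q u x != 0 & feeds z u s) ->
  (forall x, b x ord_max * p x ord_max != 0 ->
     (exists u, [/\ Q u ord0 = 0, Q u x != 0 & feeds z u ord_max]) \/
     p x ord_max <= \sum_u tau u * Q u x) ->
  exists q c, [/\ is_pmfXS q, steer_const^-1 <= c, - steer_const <= v q,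
    (forall x s, c * (b x s * p x s) <= mass b p * q x s) &
    c * p ord0 ord_max = mass b p * q ord0 ord_max].
Proof.
move=> p0 bv m0 z0 tau0 tauP tauS Hlow Htop.
have b0 x s : 0 <= b x s by case: (bv x s).
have b1 x s : b x s <= 1 by case: (bv x s).
pose P := mass b p.
pose h (u : X) (s : S) : R := if ~~ feasible ms s u z then 0
  else if (s + z == ms + u)%N && (Q u ord0 != 0) then q0 * tau u / P else 1.
(* Since [b] is 1 at the corner, [P] is at least the corner weight of [p], hence at least
   [tau u * Q u ord0]. The factor [q0] makes up for [Q u ord0] and keeps [h] at most 1. *)
have tauP1 u : q0 * tau u <= P.
  have [->|tn] := eqVneq (tau u) 0; first by rewrite mulr0 ltW.
  have [qn _] := tauP u tn.
  apply: (@le_trans _ _ (p ord0 ord_max)).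
    rewrite -tauS (bigD1 u) //= mulrC (@le_trans _ _ (tau u * Q u ord0)) //.
      by rewrite ler_wpM2l // q0P.
    by rewrite lerDl sumr_ge0 // => i _; rewrite mulr_ge0 // sto_ge0.
  rewrite -[leLHS]mul1r -(valid_weight0_corner bv); exact: mass_ge_term.
have h0 u s : 0 <= h u s.
  rewrite /h; case: ifP => // _; case: ifP => // _.
  by rewrite divr_ge0 ?(ltW m0) // mulr_ge0 // ltW.
have hv : valid_weight z h.
  move=> u s; split=> //; rewrite /h.
  - case: ifP => // _; case: ifP => // _; by rewrite ler_pdivrMr // mul1r.
  - by case: ifP => [_|/negbT]; rewrite ?eqxx // negbK.
  case: ifP => [nf _|/negbT]; last first.
    rewrite negbK => fe; case: ifP => [/andP[/eqP e _] _|_]; last by rewrite eqxx.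
    (* The letter [my] is forced only with an empty battery, which it leaves empty; such a
       transition does not lead to charge [ms]. *)
    apply: other_letter => -[e1 e2 e3]; [by rewrite e1 in z0 | natlia].
  have hf := hold_feasible le_mx_my u s.
  by exists (hold_letter my u s) => //; apply: contraNneq nf => <-.
have n0 : 0 <= n^-1 by rewrite invr_ge0 ltW.
have q0n : 0 < q0 / n by rewrite divr_gt0.
have q0n' := ltW q0n.
have termle u x (s s0 : S) : (s0 + z = s + u)%N -> Q u x * h u s0 * n^-1 <= push Q h unif z x s.
  move=> e; rewrite /push (bigD1 u) //= (bigD1 s0) /=; last exact/eqP.
  rewrite -addrA lerDl addr_ge0 //.
    by apply: sumr_ge0 => i _; rewrite !mulr_ge0 // sto_ge0.
  by apply: sumr_ge0 => i _; apply: sumr_ge0 => j _; rewrite !mulr_ge0 // sto_ge0.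
have inner u x : Q u ord0 != 0 ->
    \sum_(s : S | (s + z == (ord_max : S) + u)%N) Q u x * h u s * n^-1
    = q0 / (P * n) * (tau u * Q u x).
  move=> qn; case: (boolP (feeds z u ord_max)) => [/existsP[s0 /eqP e]|nf].
    rewrite (big_pred1 s0) => [|s /=]; last first.
      by rewrite -e eqn_add2r.
    have -> : h u s0 = q0 * tau u / P.
      by rewrite /h (feasible_next e (leqnn _)) /=; move: e => /= ->; rewrite eqxx qn.
    by field; rewrite !gt_eqF.
  rewrite big_pred0 => [|s]; last by apply: contraNF nf => es; apply/existsP; exists s.
  suff -> : tau u = 0 by rewrite mul0r mulr0.
  by apply/eqP; apply: contraNT nf => /tauP[].
have corner : P * push Q h unif z ord0 ord_max = q0 / n * p ord0 ord_max.
  rewrite -tauS mulr_sumr /push mulr_sumr; apply: eq_bigr => u _.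
  have [e|qn] := eqVneq (Q u ord0) 0.
    by rewrite e !mulr0 big1 ?mulr0 // => s _; rewrite !mul0r.
  by rewrite inner //; field; rewrite !gt_eqF.
have full u x (s : S) : feeds z u s -> (s != ord_max) || (Q u ord0 == 0) -> Q u x != 0 ->
    q0 / n <= push Q h unif z x s.
  move=> /existsP[s0 /eqP e] hs qn; apply: le_trans (termle u x s s0 e).
  have -> : h u s0 = 1.
    rewrite /h (feasible_next e (ltn_ord s)) /=.
    case: ifP => // /andP[/eqP e2 q2]; move: hs; rewrite (negbTE q2) orbF => /eqP; case.
    by apply/val_inj/eqP; rewrite -(eqn_add2r u) /= -e2 -e.
  by rewrite mulr1 ler_wpM2r // q0P.
(* A state fed with full weight receives at least [q0 / n], which suffices because [b * p] is at
   most [P]. The remaining states, at charge [ms], are compared term by term with the flow through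
   [tau]. *)
have dom x s : q0 / n * (b x s * p x s) <= P * push Q h unif z x s.
  have [->|bpn] := eqVneq (b x s * p x s) 0.
    rewrite mulr0 mulr_ge0 ?(ltW m0) // push_ge0 //; exact: sto_ge0.
  have viafull : q0 / n <= push Q h unif z x s -> q0 / n * (b x s * p x s) <= P * push Q h unif z x s.
    move=> pf; rewrite mulrC; apply: (@le_trans _ _ (P * (q0 / n))).
      by rewrite ler_wpM2r //; exact: mass_ge_term.
    by rewrite ler_wpM2l // ltW.
  have [es|sn] := eqVneq s ord_max; last first.
    have [u qn fu] := Hlow x s bpn sn; apply: viafull; apply: (full u) => //.
    by rewrite sn.
  rewrite es in bpn viafull *; have [[u [e qn fu]]|le_p] := Htop x bpn.
    by apply: viafull; apply: (full u) => //; rewrite e !eqxx.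
  apply: (@le_trans _ _ (q0 / n * p x ord_max)).
    by rewrite ler_wpM2l // ler_piMl.
  apply: (@le_trans _ _ (q0 / n * \sum_u tau u * Q u x)).
    by rewrite ler_wpM2l.
  rewrite /push !mulr_sumr; apply: ler_sum => u _.
  have [e|qn] := eqVneq (Q u ord0) 0.
    have -> : tau u = 0 by apply/eqP; apply: contraTT isT => /tauP[]; rewrite e eqxx.
    rewrite mul0r mulr0 mulr_ge0 ?(ltW m0) // sumr_ge0 // => i _.
    by rewrite !mulr_ge0 // sto_ge0.
  rewrite inner //; have -> : P * (q0 / (P * n) * (tau u * Q u x)) = q0 / n * (tau u * Q u x).
    by field; rewrite !gt_eqF.
  exact: lexx.
pose d := mass h unif.
have dE : \sum_x \sum_s push Q h unif z x s = d.
  by apply: mass_push => // x s; case: (hv x s).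
have d_ge : q0 / n <= d.
  rewrite -(ler_pM2r m0) -dE mulr_suml {1}/mass mulr_sumr; apply: ler_sum => x _.
  rewrite mulr_suml mulr_sumr; apply: ler_sum => s _.
  by rewrite [leRHS]mulrC; exact: dom.
have d_gt0 : 0 < d by apply: lt_le_trans d_ge.
have d_le1 : d <= 1 by apply: mass_le1; [move=> x s; case: (hv x s) | exact: unif_pmf].
have a1 : 1 <= `|v unif| + K + 1 by rewrite lerDr addr_ge0.
exists (post Q unif z h), (q0 / n / d); split.
- apply: pmf_post => //; last exact: unif_pmf.
  by move=> x s; case: (hv x s).
- apply: (@le_trans _ _ (q0 / n)); last by rewrite ler_pdivlMr // ler_piMr // ltW.
  rewrite /steer_const invfM invf_div ler_piMl // ?(ltW q0n) //.
  by rewrite invf_le1 // (lt_le_trans ltr01).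
- apply: (@le_trans _ _ (- ((`|v unif| + K) / (q0 / n)))).
    rewrite lerN2 /steer_const invf_div ler_wpM2r ?divr_ge0 ?(ltW n_gt0) ?(ltW q0_gt0) //.
    by rewrite lerDl.
  apply: post_value_ge => //; first exact: unif_pmf.
  exact: oppr_norm_le.
- by move=> x s; rewrite /post -/d mulrA mulrAC ler_pM2r ?invr_gt0 // dom.
- by rewrite /post -/d mulrA -/P corner mulrAC.
Qed.

(** Joint posterior of the demand [u] just served and the charge [s'] left behind, before the next
    demand is drawn. *)
Definition inflow p y h (u : X) (s' : S) : R :=
  (\sum_(s : S | (s + y == s' + u)%N) h u s * p u s) / mass h p.

Lemma inflow_ge0 p y h u s' : is_pmfXS p -> valid_weight y h -> 0 < mass h p ->
  0 <= inflow p y h u s'.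
Proof.
move=> [p0 _] hv m0; rewrite divr_ge0 ?(ltW m0) // sumr_ge0 // => s _.
by rewrite mulr_ge0 //; case: (hv u s).
Qed.

Lemma post_inflow p y h x s' : post Q p y h x s' = \sum_u inflow p y h u s' * Q u x.
Proof.
rewrite /post /push mulr_suml; apply: eq_bigr => u _.
rewrite /inflow mulr_suml [RHS]mulrAC mulr_suml mulr_suml; apply: eq_bigr => s _; ring.
Qed.

Lemma inflow_feeds p y h u s' : inflow p y h u s' != 0 -> feeds y u s'.
Proof.
apply: contraNT => nf; rewrite /inflow big_pred0 ?mul0r // => s.
by apply: contraNF nf => e; apply/existsP; exists s.
Qed.

Lemma post_feeds p y h x s' : post Q p y h x s' != 0 ->
  exists2 u, Q u x != 0 & inflow p y h u s' != 0.
Proof.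
rewrite post_inflow => pn; apply: contrapT => nE; move/eqP: pn; apply.
apply: big1 => u _; apply/eqP; apply: contrapT => /negP; rewrite mulf_eq0 negb_or.
by move=> /andP[e1 e2]; apply: nE; exists u.
Qed.

(** The letter [z] that produced the belief also steers to it: it feeds every state of positive
    weight, and [tau], the inflow from demands that can be followed by 0, reproduces the corner. A
    state at charge [ms] not covered by [tau] has a predecessor that cannot lead to the corner, so
    full weight is harmless there. *)
Lemma post_dominated_neq0 p (z : Y) h : is_pmfXS p -> valid_weight z h -> 0 < mass h p ->
  z != 0%N :> nat -> dominated 0 steer_const (post Q p z h).
Proof.
move=> pp hv m0 z0 b bv _ bm0.
pose tau u := if Q u ord0 == 0 then 0 else inflow p z h u ord_max.
have in0 u s : 0 <= inflow p z h u s by exact: inflow_ge0.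
apply: (@steer_dominated _ _ z tau) => //.
- move=> x s; rewrite post_inflow sumr_ge0 // => u _; rewrite mulr_ge0 //; exact: sto_ge0.
- by move=> u; rewrite /tau; case: ifP.
- move=> u; rewrite /tau; case: ifP => [_|/negbT qn inn]; first by rewrite eqxx.
  by split=> //; exact: inflow_feeds inn.
- rewrite post_inflow; apply: eq_bigr => u _; rewrite /tau; case: ifP => // /eqP ->.
  by rewrite !mulr0.
- move=> x s; rewrite mulf_eq0 negb_or => /andP[_ /post_feeds[u qn inn]] _.
  by exists u => //; exact: inflow_feeds inn.
move=> x _.
have [[u [e1 e2 e3]]|nE] := pselect (exists u, [/\ Q u ord0 = 0, Q u x != 0 & inflow p z h u ord_max != 0]).
  by left; exists u; split=> //; exact: inflow_feeds e3.
right; rewrite post_inflow; apply: ler_sum => u _; rewrite /tau; case: ifP => [/eqP e|//].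
rewrite mul0r; have [->|qn] := eqVneq (Q u x) 0; first by rewrite mulr0.
have [->|inn] := eqVneq (inflow p z h u ord_max) 0; first by rewrite mul0r.
by exfalso; apply: nE; exists u.
Qed.

Lemma inflow0_top p h u : inflow p letter0 h u ord_max != 0 -> u = ord0.
Proof.
move=> /inflow_feeds/existsP[s0 /eqP e]; apply/val_inj => /=; have := ltn_ord s0.
by move: e => /=; natlia.
Qed.

(* After a letter 0 the letter 1 could have fed every state but [(0, 0)]. *)
Lemma post_dominated_eq0 p h : is_pmfXS p -> valid_weight letter0 h -> 0 < mass h p ->
  (Q ord0 ord0 = 0 \/ exists u : X, [/\ (0 < u)%N, (u <= ms.+1)%N & Q u ord0 != 0]) ->
  dominated 0 steer_const (post Q p letter0 h).
Proof.
move=> pp hv m0 cA b bv _ bm0.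
have my_gt0 : (0 < my)%N by natlia.
have [z zE] : exists z : Y, z = 1%N :> nat by exists (inord 1); rewrite inordK.
pose tau u := if (u == ord0) && (Q ord0 ord0 != 0) then inflow p letter0 h u ord_max else 0.
have in0 u s : 0 <= inflow p letter0 h u s by exact: inflow_ge0.
have f0 : feeds z ord0 ord_max.
  by apply/existsP; exists (inord ms.-1); rewrite zE inordK /=; natlia.
have topE x : post Q p letter0 h x ord_max = inflow p letter0 h ord0 ord_max * Q ord0 x.
  rewrite post_inflow (bigD1 ord0) //= big1 ?addr0 // => u un.
  have [->|/inflow0_top e] := eqVneq (inflow p letter0 h u ord_max) 0; first by rewrite mul0r.
  by rewrite e eqxx in un.
have tauS x : Q ord0 ord0 != 0 ->
    \sum_u tau u * Q u x = inflow p letter0 h ord0 ord_max * Q ord0 x.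
  move=> qn; rewrite (bigD1 ord0) //= {1}/tau eqxx qn big1 ?addr0 // => u /negbTE un.
  by rewrite /tau un mul0r.
apply: (@steer_dominated _ _ z tau) => //.
- move=> x s; rewrite post_inflow sumr_ge0 // => u _; rewrite mulr_ge0 //; exact: sto_ge0.
- by rewrite zE.
- by move=> u; rewrite /tau; case: ifP.
- move=> u; rewrite /tau; case: ifP => [/andP[/eqP -> qn] _|_]; last by rewrite eqxx.
  by [].
- rewrite topE; have [e|qn] := eqVneq (Q ord0 ord0) 0; last exact: tauS.
  by rewrite e mulr0 big1 // => u _; rewrite /tau e eqxx andbF mul0r.
- move=> x s bpn sn.
  have [bn /post_feeds[u qn /inflow_feeds/existsP[s0 /eqP /= e]]] :
    b x s != 0 /\ post Q p letter0 h x s != 0 by move: bpn; rewrite mulf_eq0 => /norP.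
  have slt : (s < ms)%N by move: sn; rewrite -val_eqE /=; have := ltn_ord s; natlia.
  case: (posnP (s + u)%N) => [su0|su]; last first.
    exists u => //; apply/existsP; exists (inord (s + u).-1).
    by rewrite zE inordK; have := ltn_ord s0; natlia.
  (* The exceptional state [(0, 0)] preceded by demand 0: the letter 1 would need a negative charge.
     It is fed instead through the demand [w] from charge [w - 1], which is in range since
     [w <= ms + 1]. *)
  have x0 : x = ord0 by apply/val_inj => /=; have := valid_weight0_le bv bn; natlia.
  have u0 : u = ord0 by apply/val_inj => /=; natlia.
  rewrite x0 u0 in qn *; case: cA => [e0|[w [w1 w2 w3]]]; first by rewrite e0 eqxx in qn.
  exists w => //; apply/existsP; exists (inord w.-1).
  by rewrite zE inordK; natlia.
move=> x; rewrite mulf_eq0 negb_or => /andP[_ pn].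
have [e|qn] := eqVneq (Q ord0 ord0) 0; last by right; rewrite tauS // topE.
left; exists ord0; split=> //; move: pn; rewrite topE.
by rewrite mulf_eq0 negb_or => /andP[].
Qed.

(** For [j = ms] the weights [b] vanish at nonzero demands. Holding a demand [u] that can be
    followed by 0 feeds all states [(0, s)] from the same charge, and [tau] concentrated at [u]
    matches the corner. *)
Lemma dominated_idle p (u : X) : is_pmfXS p -> (0 < u)%N -> Q u ord0 != 0 ->
  dominated ms steer_const p.
Proof.
move=> pp u0 qn b bv bj bm0; have p0 := pp.1.
have bx x s : (0 < x)%N -> b x s = 0.
  move=> x0; apply/eqP; apply: contrapT => /negP /bj /(_ x0); have := ltn_ord s; natlia.
have [z zE] : exists z : Y, z = u :> nat.
  by exists (inord u); rewrite inordK //; have := ltn_ord u; natlia.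
pose tau w := if w == u then p ord0 ord_max / Q u ord0 else 0.
have fz s : feeds z u s by apply/existsP; exists s; rewrite zE.
have tauS x : \sum_w tau w * Q w x = p ord0 ord_max / Q u ord0 * Q u x.
  rewrite (bigD1 u) //= {1}/tau eqxx big1 ?addr0 // => w /negbTE wn.
  by rewrite /tau wn mul0r.
apply: (@steer_dominated _ _ z tau) => //.
- by rewrite zE; natlia.
- move=> w; rewrite /tau; case: ifP => // _; rewrite divr_ge0 //; exact: sto_ge0.
- by move=> w; rewrite /tau; case: ifP => [/eqP -> _|_]; rewrite ?eqxx.
- by rewrite tauS divfK.
- move=> x s; rewrite mulf_eq0 negb_or => /andP[bn _] _; exists u => //.
  suff -> : x = ord0 by [].
  apply/val_inj => /=; case: (posnP x) => // x0; by rewrite bx // eqxx in bn.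
move=> x; rewrite mulf_eq0 negb_or => /andP[bn _]; right.
suff -> : x = ord0 by rewrite tauS divfK.
apply/val_inj => /=; case: (posnP x) => // x0; by rewrite bx // eqxx in bn.
Qed.

(* The weights [b] after the letter 0 are pulled back to weights [c0] before it. *)
Lemma post_dominatedS j B p h : 0 < B -> is_pmfXS p -> valid_weight letter0 h -> 0 < mass h p ->
  Q ord0 ord0 != 0 ->
  (forall u : X, (0 < u)%N -> (u <= ms.+1)%N -> Q u ord0 = 0) ->
  dominated j.+1 B p -> dominated j ((B + K) * B + q0^-1) (post Q p letter0 h).
Proof.
move=> B0 pp hv m0 q00 noret H b bv bj bm0; have p0 := pp.1.
have b0 x s : 0 <= b x s by case: (bv x s).
have b1 x s : b x s <= 1 by case: (bv x s).
have h0 x s : 0 <= h x s by case: (hv x s).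
have h1 x s : h x s <= 1 by case: (hv x s).
pose A (x : X) (s : S) := \sum_x' Q x x' * \sum_(s' : S | (s + letter0 == s' + x)%N) b x' s'.
have A0 x s : 0 <= A x s.
  by apply: sumr_ge0 => x' _; rewrite mulr_ge0 ?sto_ge0 // sumr_ge0.
have A1 x s : A x s <= 1.
  rewrite -(sto_sum stoQ x); apply: ler_sum => x' _; rewrite ler_piMr ?sto_ge0 //.
  apply: (@le_trans _ _ (\sum_(s' : S | (s + letter0 == s' + x)%N) 1)).
    exact: ler_sum.
  by rewrite sum_next_const; case: ifP.
(* [A] averages the later weights over the next demand. Dividing by [q0] makes it dominate [b] along
   every possible transition; truncating at 1 keeps a valid weight, equal to 1 at the corner. *)
pose c0 x s := h x s * Num.min 1 (A x s / q0).
have Ale x s (x' : X) (s' : S) : (s + letter0 == s' + x)%N -> Q x x' != 0 ->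
    b x' s' <= Num.min 1 (A x s / q0).
  move=> e qn; rewrite le_min b1 /= ler_pdivlMr // /A (bigD1 x') //= (bigD1 s') //=.
  rewrite mulrDr -addrA (@le_trans _ _ (Q x x' * b x' s')) //.
    by rewrite mulrC ler_wpM2r // q0P.
  rewrite lerDl addr_ge0 //; first by rewrite mulr_ge0 ?sto_ge0 // sumr_ge0.
  by apply: sumr_ge0 => i _; rewrite mulr_ge0 ?sto_ge0 // sumr_ge0.
have corner : Num.min 1 (A ord0 ord_max / q0) = 1.
  apply/le_anti; rewrite ge_min lexx /=.
  by have := Ale ord0 ord_max ord0 ord_max (eqxx _) q00; rewrite (valid_weight0_corner bv).
have A_le_min x s : A x s <= Num.min 1 (A x s / q0).
  by rewrite le_min A1 /= ler_pdivlMr // ler_piMr.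
have c0v : valid_weight letter0 c0.
  apply: valid_weight0 => [x s|x s|x s|].
  - by rewrite mulr_ge0 // le_min ler01 divr_ge0 // ltW.
  - apply: (@le_trans _ _ (1 * 1)); last by rewrite mulr1.
    by apply: ler_pM => //; rewrite ?le_min ?ge_min ?lexx ?ler01 ?divr_ge0 // ltW.
  - by rewrite mulf_eq0 negb_or => /andP[/(valid_weight0_le hv)].
  - by rewrite /c0 corner (valid_weight0_corner hv) mulr1.
(* A positive demand met by the battery alone is at most [ms], so by [noret] the next demand is at
   least 1. This extra unit raises [j] to [j + 1]. *)
have c0j x s : c0 x s != 0 -> (0 < x)%N -> (x + j.+1 <= s)%N.
  rewrite mulf_eq0 negb_or => /andP[hn mn] x0.
  have xs := valid_weight0_le hv hn.
  have An : A x s != 0.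
    apply: contraNneq mn => ->; rewrite mul0r; apply/eqP/min_idPr; exact: ler01.
  have : 0 < A x s by rewrite lt0r An A0.
  move=> /sum_gt0_exists[x' Ax'].
  have [qn bn] : Q x x' != 0 /\ \sum_(s' : S | (s + letter0 == s' + x)%N) b x' s' != 0.
    by apply/norP; rewrite -mulf_eq0 gt_eqF.
  have [s' /eqP es bsn] : exists2 s' : S, (s + letter0 == s' + x)%N & b x' s' != 0.
    apply: contrapT => nE; move/eqP: bn; apply; apply: big1 => s' es.
    by apply/eqP; apply: contrapT => /negP bsn; apply: nE; exists s'.
  have x'0 : (0 < x')%N.
    rewrite lt0n; apply/eqP => e; have e' : x' = ord0 by exact: val_inj.
    by move: qn; rewrite e' noret ?eqxx //; have := ltn_ord s; natlia.
  have := bj x' s' bsn x'0; move: es => /=; natlia.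
pose P := mass h p; pose P' := mass b (post Q p letter0 h); pose P0 := mass c0 p.
have PP' : P * P' = \sum_x \sum_s h x s * p x s * A x s.
  rewrite -(push_sum Q h p letter0 b) /P' {1}/mass mulr_sumr; apply: eq_bigr => x _.
  rewrite mulr_sumr; apply: eq_bigr => s _; rewrite /post -/P.
  by field; rewrite gt_eqF.
have P0_ge : P * P' <= P0.
  rewrite PP'; apply: ler_sum => x _; apply: ler_sum => s _.
  by rewrite /c0 mulrAC ler_wpM2r // ler_wpM2l.
have P0_le : q0 * P0 <= P * P'.
  rewrite PP' /P0 /mass mulr_sumr; apply: ler_sum => x _.
  rewrite mulr_sumr; apply: ler_sum => s _.
  rewrite /c0 mulrA mulrC [leRHS]mulrAC mulrC [q0 * _]mulrCA ler_wpM2r // ler_wpM2l //.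
  by rewrite -ler_pdivlMl // mulrC ge_min lexx orbT.
have PP'_gt0 : 0 < P * P' by rewrite mulr_gt0.
have P0_gt0 : 0 < P0 by apply: lt_le_trans P0_ge.
have vq := dominated_value B0 pp H c0v c0j P0_gt0.
have qinv : 0 < q0^-1 by rewrite invr_gt0.
have BKB : 0 <= (B + K) * B by rewrite mulr_ge0 ?addr_ge0 // ltW.
(* [P * P'] is the probability of two letters 0 with weights [h] and [b], [P0] that of one letter 0
   with weight [c0]; their ratio is at least [q0]. *)
exists (post Q p letter0 c0), (P * P' / P0); split.
- by apply: pmf_post => // x s; case: (c0v x s).
- apply: (@le_trans _ _ q0); last by rewrite ler_pdivlMr.
  by rewrite -[leRHS]invrK lef_pV2 ?posrE ?lerDr // ltr_wpDl.
- by apply: le_trans vq; rewrite lerN2 lerDl ltW.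
- move=> x' s'; rewrite /post -/P -/P0 -/P'.
  have -> : P * P' / P0 * (b x' s' * (push Q h p letter0 x' s' / P))
    = P' / P0 * (b x' s' * push Q h p letter0 x' s') by field; rewrite !gt_eqF.
  have -> : P' * (push Q c0 p letter0 x' s' / P0) = P' / P0 * push Q c0 p letter0 x' s' by ring.
  rewrite ler_wpM2l ?divr_ge0 ?(ltW bm0) ?(ltW P0_gt0) //.
  rewrite mulr_sumr; apply: ler_sum => x _; rewrite mulr_sumr; apply: ler_sum => s es.
  have [->|qn] := eqVneq (Q x x') 0; first by rewrite !mul0r mulr0.
  have -> : Q x x' * c0 x s * p x s = Q x x' * h x s * p x s * Num.min 1 (A x s / q0).
    by rewrite /c0; ring.
  rewrite mulrC ler_wpM2l ?mulr_ge0 ?sto_ge0 //; exact: Ale es qn.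
- rewrite /post -/P -/P0 -/P'.
  have pE g : push Q g p letter0 ord0 ord_max = Q ord0 ord0 * g ord0 ord_max * p ord0 ord_max.
    rewrite /push (bigD1 ord0) //= [X in _ + X]big1 ?addr0 => [|x xn].
      rewrite (big_pred1 ord_max) // => s /=; by rewrite -val_eqE /= !addn0.
    rewrite big_pred0 // => s /=; have := ltn_ord s; move: xn; rewrite -val_eqE /=; natlia.
  rewrite !pE /c0 corner (valid_weight0_corner hv).
  by field; rewrite !gt_eqF.
Qed.

Hypothesis column0 : exists2 u : X, (0 < u)%N & Q u ord0 != 0.

(** If no demand in [1..ms+1] can be followed by 0, a positive demand served by letters 0 stays
    positive and drains the battery at every step, so only boundedly many such letters can follow.
    The induction starts at [j = ms], where the relevant demand is 0, and lowers [j] to 0. *)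
Lemma reachable_dominated p1 : is_pmfXS p1 -> exists2 B, 0 < B &
  forall p, reachable my Q p1 p -> dominated 0 B p.
Proof.
move=> pp1; have [B1 B10 H1] := start_dominated pp1.
have sc0 := steer_const_gt0.
have [cA|ncA] := pselect (Q ord0 ord0 = 0 \/
    exists u : X, [/\ (0 < u)%N, (u <= ms.+1)%N & Q u ord0 != 0]).
  exists (B1 + steer_const); first exact: addr_gt0.
  move=> p; case=> [|{}p y h op hv m0].
    by apply: dominated_mono H1; rewrite // lerDl ltW.
  apply: (@dominated_mono _ steer_const) => //; first by rewrite lerDr ltW.
  have pp := reachable_pmf stoQ pp1 op.
  have [y0|y0] := eqVneq (y : nat) 0%N; last by apply: post_dominated_neq0.
  have ye : y = letter0 by exact: val_inj.
  by rewrite ye in hv *; apply: post_dominated_eq0.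
have q00 : Q ord0 ord0 != 0 by apply/eqP => e; apply: ncA; left.
have noret (u : X) : (0 < u)%N -> (u <= ms.+1)%N -> Q u ord0 = 0.
  move=> u0 u1; apply/eqP; apply: contrapT => /negP qn; apply: ncA; right; by exists u.
have step k : (k <= ms)%N -> exists2 B, 0 < B & forall p, reachable my Q p1 p -> dominated (ms - k) B p.
  elim: k => [_|k IH km].
    exists steer_const => // p op; rewrite subn0; have [u u0 qn] := column0.
    exact: (dominated_idle (reachable_pmf stoQ pp1 op) u0 qn).
  have [B B0 H] := IH (ltnW km).
  have BKB : 0 <= (B + K) * B by rewrite mulr_ge0 ?addr_ge0 // ltW.
  have B'0 : 0 < (B + K) * B + q0^-1 by rewrite ltr_wpDl ?invr_gt0.
  exists (B1 + steer_const + ((B + K) * B + q0^-1)).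
    by apply: addr_gt0 => //; apply: addr_gt0.
  move=> p; case=> [|{}p y h op hv m0].
    apply: (@dominated_mono _ B1) => //; first by rewrite -addrA lerDl addr_ge0 // ltW.
    exact: dominated0.
  have pp := reachable_pmf stoQ pp1 op.
  have [y0|y0] := eqVneq (y : nat) 0%N.
    apply: (@dominated_mono _ ((B + K) * B + q0^-1)) => //.
      by rewrite lerDr addr_ge0 // ltW.
    have ye : y = letter0 by exact: val_inj.
    rewrite ye in hv *; apply: post_dominatedS => //.
    have -> : (ms - k.+1).+1 = (ms - k)%N by natlia.
    exact: H.
  apply: (@dominated_mono _ steer_const) => //.
    by rewrite addrAC lerDr addr_ge0 // ltW.
  by apply: dominated0; apply: post_dominated_neq0.
by have := step ms (leqnn _); rewrite subnn.
Qed.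

Lemma letter0_value_ge p1 : is_pmfXS p1 -> exists2 B, 0 <= B &
  forall p h, reachable my Q p1 p -> valid_weight letter0 h -> 0 < mass h p ->
  - B <= v (post Q p letter0 h).
Proof.
move=> pp1; have [B B0 H] := reachable_dominated pp1.
exists ((B + K) * B); first by rewrite mulr_ge0 ?addr_ge0 // ltW.
move=> p h op hv m0; apply: (dominated_value (j := 0) B0) => //.
- exact: (reachable_pmf stoQ pp1 op).
- exact: H.
- by move=> x s /(valid_weight0_le hv); natlia.
Qed.

End LowerBound.

(** * Exchange of full and empty battery when [my = mx] *)

Section Reflection.
Variables (R : realType) (mx ms : nat) (Q : 'M[R]_mx.+1).
Local Notation X := 'I_mx.+1.
Local Notation S := 'I_ms.+1.
Implicit Types (p h : X -> S -> R) (y : X).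

Definition mirror p : X -> S -> R := fun x s => p (rev_ord x) (rev_ord s).

Definition mirror_mx : 'M[R]_mx.+1 := \matrix_(i, j) Q (rev_ord i) (rev_ord j).

Lemma mirrorK : involutive mirror.
Proof. by move=> p; apply/funext => x; apply/funext => s; rewrite /mirror !rev_ordK. Qed.

Lemma sum_mirror p : \sum_x \sum_s mirror p x s = \sum_x \sum_s p x s.
Proof.
rewrite [RHS](reindex_inj rev_ord_inj) /=; apply: eq_bigr => x _.
by rewrite [RHS](reindex_inj rev_ord_inj).
Qed.

Lemma mass_mirror h p : mass (mirror h) (mirror p) = mass h p.
Proof. exact: (sum_mirror (fun x s => h x s * p x s)). Qed.

Lemma pmf_mirror p : is_pmfXS p -> is_pmfXS (mirror p).
Proof. by move=> [p0 p1]; split; [move=> x s; exact: p0 | rewrite sum_mirror]. Qed.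

Lemma stochastic_mirror : stochastic Q -> stochastic mirror_mx.
Proof.
move=> [Q0 Q1]; split=> [i j|i]; first by rewrite mxE.
by rewrite -(Q1 (rev_ord i)) [RHS](reindex_inj rev_ord_inj); apply: eq_bigr => j _; rewrite mxE.
Qed.

Lemma post_mirror p y h :
  post mirror_mx (mirror p) (rev_ord y) (mirror h) = mirror (post Q p y h).
Proof.
apply/funext => x'; apply/funext => s'; rewrite /post mass_mirror {2}/mirror; congr (_ / _).
rewrite /push [RHS](reindex_inj rev_ord_inj) /=; apply: eq_bigr => x _.
rewrite [RHS](reindex_inj rev_ord_inj) /=; apply: eq_big => [s|s _].
  have := ltn_ord s; have := ltn_ord x; have := ltn_ord s'; have := ltn_ord y; lia.
by rewrite mxE !/mirror.
Qed.

Lemma feasible_mirror (x : X) (s : S) y :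
  feasible ms (rev_ord s) (rev_ord x) (rev_ord y) = feasible ms s x y.
Proof.
rewrite /feasible /=; have := ltn_ord s; have := ltn_ord x; have := ltn_ord y; lia.
Qed.

Lemma valid_weight_mirror y h : valid_weight y h -> valid_weight (rev_ord y) (mirror h).
Proof.
move=> hv x s; have [h0 h1 hf ho] := hv (rev_ord x) (rev_ord s); split=> //.
  by move=> /hf; rewrite -feasible_mirror !rev_ordK.
move=> /ho[y' yn yf]; exists (rev_ord y'); first by rewrite (inj_eq rev_ord_inj).
by rewrite -feasible_mirror rev_ordK.
Qed.

Lemma reach_bound_mirror (v : (X -> S -> R) -> R) K :
  reach_bound mx Q v K -> reach_bound mx mirror_mx (fun p => v (mirror p)) K.
Proof.
move=> H p y h pp hv m0.
have := H (mirror p) (rev_ord y) (mirror h) (pmf_mirror pp) (valid_weight_mirror hv).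
rewrite mass_mirror => /(_ m0).
suff -> : mirror (post mirror_mx p y h) = post Q (mirror p) (rev_ord y) (mirror h) by [].
by rewrite -[p in LHS]mirrorK -[h in LHS]mirrorK -[y in LHS]rev_ordK post_mirror mirrorK.
Qed.

Lemma reachable_mirror p1 p : reachable mx Q p1 p ->
  reachable mx mirror_mx (mirror p1) (mirror p).
Proof.
elim=> [|{}p y h _ IH hv m0]; first exact: reachable_start.
rewrite -post_mirror; apply: reachable_step => //; first exact: valid_weight_mirror.
by rewrite mass_mirror.
Qed.

End Reflection.

(** * Lower bound at all reachable posteriors *)

Section ValueLowerBound.
Variables (R : realType) (mx my ms : nat) (Q : 'M[R]_mx.+1).
Local Notation X := 'I_mx.+1.
Local Notation Y := 'I_my.+1.
Local Notation S := 'I_ms.+1.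
Variables (v : (X -> S -> R) -> R) (K : R).
Hypotheses (stoQ : stochastic Q) (mx_gt0 : (0 < mx)%N) (le_mx_my : (mx <= my)%N) (K_ge0 : 0 <= K).
Hypothesis reach : reach_bound my Q v K.
Hypothesis column : forall i : X, exists2 u : X, u != i & Q u i != 0.

(** Without a battery the letter equals the demand, so every posterior is given by a row of [Q]. *)
Lemma value_lower_bound_nobattery : ms = 0%N -> exists2 B, 0 <= B &
  forall p (y : Y) h, valid_weight y h -> 0 < mass h p -> - B <= v (post Q p y h).
Proof.
move=> ms0; have [B B0 H] := finite_upper_bound (fun x : X => - v (fun x' _ => Q x x')).
have s0 (s : S) : s = 0%N :> nat by have := ltn_ord s; lia.
have sE (s : S) : s = ord0 by exact/val_inj/s0.
exists B => // p y h hv m0; rewrite lerNl.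
have only x s : h x s != 0 -> x = y :> nat.
  move=> hn; case: (hv x s) => _ _ /(_ hn) + _; rewrite /feasible !s0; lia.
have [x1 [s1 hp]] := mass_gt0_exists m0.
have x1y : x1 = y :> nat by apply: (only x1 s1); apply: contraTneq hp => ->; rewrite mul0r ltxx.
have z x s : x != x1 -> h x s = 0.
  move=> xn; apply/eqP; apply: contraNT xn => /only e; apply/eqP/val_inj; by rewrite /= x1y.
suff -> : post Q p y h = (fun x' _ => Q x1 x') by exact: H.
have mE : mass h p = h x1 ord0 * p x1 ord0.
  rewrite /mass (bigD1 x1) //= [X in _ + X]big1 ?addr0 => [|x xn].
    by rewrite (big_pred1 ord0) // => s; rewrite (sE s) /= eqxx.
  by apply: big1 => s _; rewrite z // mul0r.
apply/funext => x'; apply/funext => s'; rewrite /post mE.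
have -> : push Q h p y x' s' = Q x1 x' * (h x1 ord0 * p x1 ord0).
  rewrite /push (bigD1 x1) //= [X in _ + X]big1 ?addr0 => [|x xn].
    rewrite (big_pred1 ord0) ?mulrA // => s.
    by rewrite !s0 x1y eqxx (sE s) /= eqxx.
  by apply: big1 => s _; rewrite z // mulr0 mul0r.
by rewrite mulfK // -mE gt_eqF.
Qed.

Lemma value_lower_bound p1 : is_pmfXS p1 -> exists2 B, 0 <= B &
  forall p (y : Y) h, reachable my Q p1 p -> valid_weight y h -> 0 < mass h p ->
  - B <= v (post Q p y h).
Proof.
move=> pp1; have [ms0|ms_gt0] := posnP ms.
  have [B B0 H] := value_lower_bound_nobattery ms0.
  by exists B => // p y h _; exact: H.
have [q0 [q0_gt0 q0_le1 q0P]] := positive_entries_lower_bound stoQ.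
have col0 : exists2 u : X, (0 < u)%N & Q u ord0 != 0.
  by have [u un qn] := column ord0; exists u => //; rewrite lt0n.
have [B1 B10 H1] := noncorner_value_ge mx_gt0 le_mx_my ms_gt0 K_ge0 reach.
have [B2 B20 H2] := letter0_value_ge stoQ mx_gt0 le_mx_my ms_gt0 K_ge0 reach q0_gt0 q0_le1 q0P
  col0 pp1.
have [B3 B30 H3] : exists2 B3, 0 <= B3 & forall p (y : Y) h, reachable my Q p1 p ->
    valid_weight y h -> 0 < mass h p -> (y == my :> nat) && (mx == my) -> - B3 <= v (post Q p y h).
  (* The largest letter can be forced only if [mx = my]; reflection then turns it into the letter
     0. *)
  have [e|ne] := eqVneq mx my; last by exists 0 => // p y h _ _ _; rewrite andbF.
  move: reach le_mx_my; rewrite -e => reach' le_mx; clear H1 H2.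
  have stoQ' := stochastic_mirror stoQ.
  have q0P' i j : mirror_mx Q i j != 0 -> q0 <= mirror_mx Q i j by rewrite mxE => /q0P.
  have col' : exists2 u : X, (0 < u)%N & mirror_mx Q u ord0 != 0.
    have [u un qn] := column ord_max; exists (rev_ord u); rewrite ?mxE ?rev_ordK /=.
      by move: un; rewrite -val_eqE /=; have := ltn_ord u; lia.
    suff -> : rev_ord ord0 = ord_max :> X by [].
    by apply/val_inj; rewrite /= subn1.
  have [B B0 H] := letter0_value_ge stoQ' mx_gt0 le_mx ms_gt0 K_ge0
    (reach_bound_mirror reach') q0_gt0 q0_le1 q0P' col' (pmf_mirror pp1).
  exists B => // p y h op hv m0 /andP[/eqP ye _].
  have := H (mirror p) (mirror h) (reachable_mirror op).
  have -> : letter0 mx = rev_ord y by apply/val_inj; rewrite /= ye; lia.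
  move=> /(_ (valid_weight_mirror hv)); rewrite mass_mirror => /(_ m0).
  by rewrite post_mirror mirrorK.
exists (B1 + B2 + B3); first by rewrite !addr_ge0.
move=> p y h op hv m0.
have [cy|ncy] := boolP ((y == my :> nat) && (mx == my)).
  by apply: le_trans (H3 p y h op hv m0 cy); rewrite lerN2 lerDr addr_ge0.
have [y0|y0] := eqVneq (y : nat) 0%N.
  have ye : y = letter0 my by exact: val_inj.
  rewrite ye in hv *; apply: le_trans (H2 p h op hv m0).
  by rewrite lerN2 addrAC lerDr addr_ge0.
apply: le_trans (H1 p y h (reachable_pmf stoQ pp1 op) hv m0 y0 ncy).
by rewrite lerN2 -addrA lerDl addr_ge0.
Qed.

End ValueLowerBound.

(** * Off-diagonal entries of an irreducible matrix *)

Lemma ord_neq_exists n (i : 'I_n.+1) : (0 < n)%N -> exists j : 'I_n.+1, j != i.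
Proof.
move=> n0; have [->|i0] := eqVneq i ord0; last by exists ord0; rewrite eq_sym.
by exists ord_max; rewrite -val_eqE /=; lia.
Qed.

Lemma irreducible_row (R : realType) n (Q : 'M[R]_n.+1) i : (0 < n)%N -> irreducible Q ->
  exists2 j, j != i & Q i j != 0.
Proof.
move=> n0 irr; apply: contrapT => nE.
have z j : j != i -> Q i j = 0.
  by move=> jn; apply/eqP; apply: contrapT => /negP qn; apply: nE; exists j.
have zk k j : j != i -> (Q ^+ k) i j = 0.
  elim: k j => [|k IH] j jn; first by rewrite expr0 mxE eq_sym (negbTE jn).
  rewrite exprS mxE (bigD1 i) //= big1 ?addr0 => [|l ln]; first by rewrite IH // mulr0.
  by rewrite z // mul0r.
have [j jn] := ord_neq_exists i n0.
by have [k] := irr i j; rewrite zk // ltxx.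
Qed.

Lemma irreducible_column (R : realType) n (Q : 'M[R]_n.+1) i : (0 < n)%N -> irreducible Q ->
  exists2 j, j != i & Q j i != 0.
Proof.
move=> n0 irr; apply: contrapT => nE.
have z j : j != i -> Q j i = 0.
  by move=> jn; apply/eqP; apply: contrapT => /negP qn; apply: nE; exists j.
have zk k j : j != i -> (Q ^+ k) j i = 0.
  elim: k j => [|k IH] j jn; first by rewrite expr0 mxE (negbTE jn).
  rewrite exprSr mxE (bigD1 i) //= big1 ?addr0 => [|l ln]; first by rewrite IH // mul0r.
  by rewrite z // mulr0.
have [j jn] := ord_neq_exists i n0.
by have [k] := irr j i; rewrite zk // ltxx.
Qed.

Lemma irreducible_diag_lt1 (R : realType) n (Q : 'M[R]_n.+1) i : (0 < n)%N ->
  stochastic Q -> irreducible Q -> Q i i < 1.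
Proof.
move=> n0 stoQ irr; have [j jn qn] := irreducible_row i n0 irr.
rewrite -(sto_sum stoQ i) (bigD1 i) //= (bigD1 j) //= ltrDl.
rewrite ltr_wpDr // ?lt0r ?qn ?sto_ge0 // sumr_ge0 // => k _; exact: sto_ge0.
Qed.

(** * Chain rule for the mutual information *)

Section MutualInformation.
Variable R : realType.

Lemma ln_le_subr1 (z : R) : 0 < z -> ln z <= z - 1.
Proof.
move=> z0; have := @le_ln1Dx R (z - 1); rewrite addrCA subrr addr0; apply; lra.
Qed.

Lemma ln_ge_1subV (z : R) : 0 < z -> 1 - z^-1 <= ln z.
Proof.
move=> z0; have zi : 0 < z^-1 by rewrite invr_gt0.
have := ln_le_subr1 zi; rewrite lnV ?posrE //; lra.
Qed.

Lemma sum_pair (I J : finType) (F : I -> J -> R) :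
  \sum_(ij : I * J) F ij.1 ij.2 = \sum_i \sum_j F i j.
Proof. by rewrite pair_bigA. Qed.

Section Basics.
Variables (A B : finType) (p : A -> B -> R).

Lemma MIE : MI p = \sum_a \sum_b
  p a b * ln (p a b / ((\sum_b' p a b') * (\sum_a' p a' b))).
Proof.
apply: eq_bigr => a _; apply: eq_bigr => b _.
by case: eqP => // ->; rewrite mul0r.
Qed.

Lemma MI_reindex (A' B' : finType) (f : A' -> A) (g : B' -> B) :
  bijective f -> bijective g -> MI p = MI (fun a b => p (f a) (g b)).
Proof.
move=> bf bg; rewrite /MI (reindex f) /=; last by apply: onW_bij.
apply: eq_bigr => a _; rewrite (reindex g) /=; last by apply: onW_bij.
apply: eq_bigr => b _; rewrite (reindex g) /=; last by apply: onW_bij.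
by rewrite [\sum_a' p a' _](reindex f) /=; last by apply: onW_bij.
Qed.

Hypothesis p_ge0 : forall a b, 0 <= p a b.

Lemma le_row a b : p a b <= \sum_b' p a b'.
Proof. by rewrite (bigD1 b) //= lerDl sumr_ge0. Qed.

Lemma le_column a b : p a b <= \sum_a' p a' b.
Proof. by rewrite (bigD1 a) //= lerDl sumr_ge0. Qed.

(** From [ln z <= z], with the column sum at least [p a b], each row contributes at most 1. The
    bound is crude but independent of [B], hence of the number of letters observed. *)
Lemma MI_le_card : MI p <= #|A|%:R.
Proof.
rewrite MIE -sum1_card natr_sum; apply: ler_sum => a _.
set u := \sum_b' p a b'.
apply: (@le_trans _ _ (\sum_b p a b / u)); last first.
  rewrite -mulr_suml -/u; have [->|un] := eqVneq u 0; first by rewrite mul0r.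
  by rewrite divff.
apply: ler_sum => b _.
have [->|pn] := eqVneq (p a b) 0; first by rewrite !mul0r.
have p0 : 0 < p a b by rewrite lt0r pn p_ge0.
have r0 := lt_le_trans p0 (le_row a b); have c0 := lt_le_trans p0 (le_column a b).
rewrite ler_wpM2l //.
have z0 : 0 < p a b / (u * \sum_a' p a' b) by rewrite divr_gt0 // mulr_gt0.
apply: (le_trans (ln_le_subr1 z0)); apply: (@le_trans _ _ (p a b / (u * \sum_a' p a' b))).
  by rewrite gerBl.
rewrite invfM mulrCA ler_piMr ?invr_ge0 ?(ltW r0) // ler_pdivrMr // mul1r; exact: le_column.
Qed.

Hypothesis p_sum1 : \sum_a \sum_b p a b = 1.

Lemma MI_ge0 : 0 <= MI p.
Proof.
rewrite MIE.
(* The joint law and the product of its marginals have equal mass; [ln z >= 1 - 1 / z] then compares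
   the terms. *)
have e0 : \sum_a \sum_b (p a b - (\sum_b' p a b') * (\sum_a' p a' b)) = 0.
  rewrite -[RHS](subrr (1 : R)).
  under eq_bigr => a _ do rewrite sumrB -mulr_sumr.
  by rewrite sumrB p_sum1 -mulr_suml p_sum1 mul1r exchange_big /= p_sum1.
rewrite -[leLHS]e0; apply: ler_sum => a _; apply: ler_sum => b _.
have [->|pn] := eqVneq (p a b) 0; first by rewrite mul0r sub0r oppr_le0 mulr_ge0 // sumr_ge0.
have p0 : 0 < p a b by rewrite lt0r pn p_ge0.
have r0 := lt_le_trans p0 (le_row a b); have c0 := lt_le_trans p0 (le_column a b).
set u := \sum_b' _ in r0 *; set w := \sum_a' _ in c0 *.
have -> : p a b - u * w = p a b * (1 - (p a b / (u * w))^-1).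
  by field; rewrite !gt_eqF.
by rewrite ler_wpM2l // ln_ge_1subV // divr_gt0 // mulr_gt0.
Qed.

End Basics.

Section ChainStep.
Variables (A B X S Y : finType).
Variables (p : A -> B -> R) (r : A -> X -> R) (k : A -> B -> X -> Y -> R) (st : A -> B -> S).
Hypotheses (p_ge0 : forall a b, 0 <= p a b) (r_ge0 : forall a x, 0 <= r a x)
  (k_ge0 : forall a b x y, 0 <= k a b x y).
Hypotheses (r_sum1 : forall a, \sum_x r a x = 1) (k_sum1 : forall a b x, \sum_y k a b x y = 1).

Definition extend (ax : A * X) (bY : B * Y) : R :=
  p ax.1 bY.1 * r ax.1 ax.2 * k ax.1 bY.1 ax.2 bY.2.

Definition out_mass b : R := \sum_a p a b.

Definition state_mass b x s : R := \sum_(a | st a b == s) p a b * r a x.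

Definition full_mass b x s y : R := \sum_(a | st a b == s) p a b * r a x * k a b x y.

Definition next_mass b y : R := \sum_x \sum_s full_mass b x s y.

(** Conditional mutual information between the state [(x, s)] and the new letter given the past
    letters [b], written with unnormalized masses. *)
Definition info_gain : R := \sum_b \sum_x \sum_s \sum_y
  full_mass b x s y * ln (full_mass b x s y * out_mass b / (state_mass b x s * next_mass b y)).

Let pw a b x y := p a b * r a x * k a b x y.

Let pw_ge0 a b x y : 0 <= pw a b x y. Proof. by rewrite !mulr_ge0. Qed.

Lemma sum_by_state b x y (G : S -> R) :
  \sum_s full_mass b x s y * G s = \sum_a pw a b x y * G (st a b).
Proof.
rewrite [RHS](partition_big (fun a => st a b) predT) //=; apply: eq_bigr => s _.
by rewrite mulr_suml; apply: eq_bigr => a /eqP <-.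
Qed.

Lemma sum_state_mass b x (G : S -> R) :
  \sum_s state_mass b x s * G s = \sum_a p a b * r a x * G (st a b).
Proof.
rewrite [RHS](partition_big (fun a => st a b) predT) //=; apply: eq_bigr => s _.
by rewrite mulr_suml; apply: eq_bigr => a /eqP <-.
Qed.

Lemma next_massE b y : next_mass b y = \sum_a \sum_x pw a b x y.
Proof.
rewrite exchange_big /=; apply: eq_bigr => x _.
transitivity (\sum_s full_mass b x s y * 1); first by apply: eq_bigr => s _; rewrite mulr1.
by rewrite (sum_by_state b x y (fun=> 1)); apply: eq_bigr => a _; rewrite mulr1.
Qed.

Lemma sum_full_mass b x s : \sum_y full_mass b x s y = state_mass b x s.
Proof.
rewrite exchange_big /=; apply: eq_bigr => a _.
by rewrite -mulr_sumr k_sum1 mulr1.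
Qed.

Lemma sum_next_mass b : \sum_y next_mass b y = out_mass b.
Proof.
under eq_bigr => y _ do rewrite next_massE.
rewrite exchange_big /=; apply: eq_bigr => a _; rewrite exchange_big /=.
under eq_bigr => x _ do rewrite -mulr_sumr k_sum1 mulr1.
by rewrite -mulr_sumr r_sum1 mulr1.
Qed.

Lemma sum_state_mass1 b : \sum_x \sum_s state_mass b x s = out_mass b.
Proof.
rewrite -sum_next_mass /next_mass [RHS]exchange_big /=; apply: eq_bigr => x _.
rewrite [RHS]exchange_big /=; apply: eq_bigr => s _; by rewrite sum_full_mass.
Qed.

Lemma out_mass_ge0 b : 0 <= out_mass b. Proof. exact: sumr_ge0. Qed.

Lemma state_mass_ge0 b x s : 0 <= state_mass b x s.
Proof. by apply: sumr_ge0 => a _; rewrite mulr_ge0. Qed.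

Lemma full_mass_ge0 b x s y : 0 <= full_mass b x s y.
Proof. by apply: sumr_ge0 => a _; rewrite !mulr_ge0. Qed.

Lemma next_mass_ge0 b y : 0 <= next_mass b y.
Proof. by apply: sumr_ge0 => x _; apply: sumr_ge0 => s _; exact: full_mass_ge0. Qed.

Let pos_facts a b x y : 0 < pw a b x y ->
  [/\ 0 < p a b, 0 < r a x & 0 < k a b x y] /\
  [/\ 0 < out_mass b, 0 < state_mass b x (st a b), 0 < full_mass b x (st a b) y
    & 0 < next_mass b y].
Proof.
move=> w0.
have : [&& p a b != 0, r a x != 0 & k a b x y != 0].
  by move: (lt0r_neq0 w0); rewrite !mulf_eq0 !negb_or andbA.
case/and3P=> pn rn kn.
have p0 : 0 < p a b by rewrite lt0r pn p_ge0.
have r0 : 0 < r a x by rewrite lt0r rn r_ge0.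
have k0 : 0 < k a b x y by rewrite lt0r kn k_ge0.
have f0 : 0 < full_mass b x (st a b) y.
  apply: (lt_le_trans w0); rewrite /full_mass (bigD1 a) //= lerDl.
  by apply: sumr_ge0 => i _; rewrite !mulr_ge0.
split; split=> //.
- by apply: (lt_le_trans p0); rewrite /out_mass (bigD1 a) //= lerDl sumr_ge0.
- apply: (@lt_le_trans _ _ (p a b * r a x)); first by rewrite mulr_gt0.
  rewrite /state_mass (bigD1 a) //= lerDl.
  by apply: sumr_ge0 => i _; rewrite mulr_ge0.
- apply: (lt_le_trans f0); rewrite /next_mass (bigD1 x) //= (bigD1 (st a b)) //=.
  rewrite -addrA lerDl addr_ge0 //.
    by apply: sumr_ge0 => i _; exact: full_mass_ge0.
  by apply: sumr_ge0 => i _; apply: sumr_ge0 => j _; exact: full_mass_ge0.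
Qed.

(** The new demand depends on the past inputs [a] alone, so [r a x] cancels and the demand adds no
    information about the past letters; only the new letter contributes. *)
Lemma MI_extendE : MI extend = MI p + \sum_a \sum_b \sum_x \sum_y
  pw a b x y * ln (k a b x y * out_mass b / next_mass b y).
Proof.
have rowE a x : \sum_bY extend (a, x) bY = (\sum_b p a b) * r a x.
  rewrite (sum_pair (fun b y => pw a b x y)) mulr_suml; apply: eq_bigr => b _.
  by rewrite -mulr_sumr k_sum1 mulr1.
have colE b y : \sum_ax extend ax (b, y) = next_mass b y.
  by rewrite (sum_pair (fun a x => pw a b x y)) next_massE.
have -> : MI extend = \sum_a \sum_x \sum_b \sum_y pw a b x y *
    ln (pw a b x y / ((\sum_b p a b) * r a x * next_mass b y)).
  rewrite MIE -[RHS]sum_pair; apply: eq_bigr => -[a x] _ /=.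
  rewrite -[RHS]sum_pair; apply: eq_bigr => -[b y] _ /=.
  by rewrite rowE colE.
rewrite MIE -big_split /=; apply: eq_bigr => a _.
rewrite exchange_big /= -big_split /=; apply: eq_bigr => b _.
have -> : p a b * ln (p a b / ((\sum_b' p a b') * out_mass b)) =
    \sum_x \sum_y pw a b x y * ln (p a b / ((\sum_b' p a b') * out_mass b)).
  under [RHS]eq_bigr => x _ do rewrite -mulr_suml /pw -mulr_sumr k_sum1 mulr1.
  by rewrite -mulr_suml -mulr_sumr r_sum1 mulr1.
rewrite -big_split /=; apply: eq_bigr => x _; rewrite -big_split /=; apply: eq_bigr => y _.
have [->|wn] := eqVneq (pw a b x y) 0; first by rewrite !mul0r addr0.
have w0 : 0 < pw a b x y by rewrite lt0r wn pw_ge0.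
have [[p0 r0 k0] [u0 s0 f0 n0]] := pos_facts w0.
have pa0 := lt_le_trans p0 (le_row p_ge0 a b).
set u := \sum_b' p a b' in pa0 *.
rewrite -mulrDr -lnM ?posrE ?divr_gt0 ?mulr_gt0 //; congr (_ * ln _).
by rewrite /pw; field; rewrite !gt_eqF.
Qed.

Lemma info_gainE : info_gain = \sum_a \sum_b \sum_x \sum_y
  pw a b x y * ln (full_mass b x (st a b) y * out_mass b
                   / (state_mass b x (st a b) * next_mass b y)).
Proof.
rewrite [RHS]exchange_big /=; apply: eq_bigr => b _.
rewrite [RHS]exchange_big /=; apply: eq_bigr => x _.
rewrite exchange_big /= [RHS]exchange_big /=; apply: eq_bigr => y _.
exact: (sum_by_state b x y (fun s => ln (full_mass b x s y * out_mass b
                   / (state_mass b x s * next_mass b y)))).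
Qed.

(* Data processing: [(x, st a b)] is a function of the input, up to the past output. *)
Lemma MI_extend_ge : MI p + info_gain <= MI extend.
Proof.
rewrite MI_extendE lerD2l info_gainE -subr_ge0 -sumrB.
(* The comparison law draws [y] from its conditional law given [(b, x, st a b)], in place of
   [k a b x y], and has the same mass. *)
have e0 : \sum_a \sum_b \sum_x \sum_y
    (pw a b x y - p a b * r a x * (full_mass b x (st a b) y / state_mass b x (st a b))) = 0.
  rewrite exchange_big big1 //= => b _; rewrite exchange_big big1 //= => x _.
  under eq_bigr => a _ do rewrite sumrB -mulr_sumr k_sum1 mulr1 -mulr_sumr -mulr_suml sum_full_mass.
  rewrite sumrB -(sum_state_mass b x (fun s => state_mass b x s / state_mass b x s)).
  have -> : \sum_a p a b * r a x = \sum_s state_mass b x s * 1.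
    rewrite (sum_state_mass b x (fun=> 1)); by apply: eq_bigr => a _; rewrite mulr1.
  rewrite -sumrB big1 // => s _.
  have [->|sn] := eqVneq (state_mass b x s) 0; first by rewrite !mul0r subrr.
  by rewrite divff // subrr.
rewrite -[leLHS]e0; apply: ler_sum => a _; rewrite -sumrB; apply: ler_sum => b _.
rewrite -sumrB; apply: ler_sum => x _; rewrite -sumrB; apply: ler_sum => y _.
have [->|wn] := eqVneq (pw a b x y) 0.
  rewrite !mul0r sub0r subrr oppr_le0; apply: mulr_ge0; first exact: mulr_ge0.
  by apply: divr_ge0; [exact: full_mass_ge0 | exact: state_mass_ge0].
have w0 : 0 < pw a b x y by rewrite lt0r wn pw_ge0.
have [[p0 r0 k0] [u0 s0 f0 n0]] := pos_facts w0.
rewrite -[leRHS]mulrBr -ln_div ?posrE ?divr_gt0 ?mulr_gt0 //.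
set z := (X in ln X).
have zE : z = k a b x y * state_mass b x (st a b) / full_mass b x (st a b) y.
  by rewrite /z; field; rewrite !gt_eqF.
have -> : pw a b x y - p a b * r a x * (full_mass b x (st a b) y / state_mass b x (st a b))
    = pw a b x y * (1 - z^-1).
  by rewrite zE /pw; field; rewrite !gt_eqF.
by rewrite ler_wpM2l // ln_ge_1subV // zE divr_gt0 // mulr_gt0.
Qed.

Lemma MI_extend_eq (act : B -> X -> S -> Y -> R) :
  (forall a b x y, k a b x y = act b x (st a b) y) -> MI extend = MI p + info_gain.
Proof.
move=> kE; rewrite MI_extendE info_gainE; congr (_ + _).
apply: eq_bigr => a _; apply: eq_bigr => b _; apply: eq_bigr => x _; apply: eq_bigr => y _.
have [->|wn] := eqVneq (pw a b x y) 0; first by rewrite !mul0r.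
have w0 : 0 < pw a b x y by rewrite lt0r wn pw_ge0.
have [[p0 r0 k0] [u0 s0 f0 n0]] := pos_facts w0.
have -> : full_mass b x (st a b) y = state_mass b x (st a b) * k a b x y.
  rewrite /full_mass /state_mass mulr_suml; apply: eq_bigr => a' /eqP e.
  by rewrite !kE e.
by congr (_ * ln _); field; rewrite !gt_eqF.
Qed.

End ChainStep.

End MutualInformation.

(** * Trajectories and beliefs under a policy *)

Lemma rcons_pair_bij (X S : finType) T :
  bijective (fun a : (T.-tuple X * S) * X => (rcons_tuple a.1.1 a.2, a.1.2)).
Proof.
apply: inj_card_bij => [[[xs s] x] [[xs' s'] x'] /= e|].
  have /rcons_inj[exs ->] := congr1 (fun c => tval c.1) e.
  by have /= -> := congr1 snd e; rewrite (val_inj exs).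
by rewrite !card_prod !card_tuple expnSr; lia.
Qed.

Lemma rcons_tuple_bij (Y : finType) T :
  bijective (fun b : T.-tuple Y * Y => rcons_tuple b.1 b.2).
Proof.
apply: inj_card_bij => [[ys y] [ys' y'] /= e|].
  by have /rcons_inj[eys ->] := congr1 (fun c => tval c) e; rewrite (val_inj eys).
by rewrite !card_prod !card_tuple expnSr.
Qed.

Section Trajectories.
Variables (R : realType) (mx my ms : nat) (Q : 'M[R]_mx.+1).
Local Notation X := 'I_mx.+1.
Local Notation Y := 'I_my.+1.
Local Notation S := 'I_ms.+1.
Variables (PX1 : X -> R) (PS1 : S -> R) (q : policy R mx my ms).

(* The charge at time [t + 1]; meaningful as long as the letters are feasible. *)
Fixpoint state (s1 : S) (xs : seq X) (ys : seq Y) (t : nat) : S :=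
  if t is t'.+1 then inord (state s1 xs ys t' + nth ord0 ys t' - nth ord0 xs t') else s1.

Definition arrival (xs : seq X) (t : nat) : R :=
  if t is t'.+1 then Q (nth ord0 xs t') (nth ord0 xs t) else PX1 (nth ord0 xs 0).

(** The joint law with the charges computed by [state]. Since [PS1 s1] stands outside the product,
    [T = 0] gives the law of the initial charge, from which the inductions start. *)
Definition traj (T : nat) (s1 : S) (xs : seq X) (ys : seq Y) : R :=
  PS1 s1 * \prod_(t < T) (arrival xs t *
    q t (take t.+1 xs) (mkseq (state s1 xs ys) t.+1) (take t ys) (nth ord0 ys t)).

Lemma eq_state s1 xs ys xs' ys' t :
  (forall i, (i < t)%N -> nth ord0 xs i = nth ord0 xs' i) ->
  (forall i, (i < t)%N -> nth ord0 ys i = nth ord0 ys' i) ->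
  state s1 xs ys t = state s1 xs' ys' t.
Proof.
elim: t => //= t IH hx hy; rewrite hx // hy // IH // => i it.
  by apply: hx; rewrite ltnS ltnW.
by apply: hy; rewrite ltnS ltnW.
Qed.

Lemma nth_rcons_lt (Z : Type) (z0 : Z) zs z i : (i < size zs)%N ->
  nth z0 (rcons zs z) i = nth z0 zs i.
Proof. by move=> h; rewrite nth_rcons h. Qed.

Lemma take_rcons_le (Z : Type) (zs : seq Z) z i : (i <= size zs)%N ->
  take i (rcons zs z) = take i zs.
Proof. by move=> h; rewrite -cats1 takel_cat. Qed.

Lemma state_rcons s1 xs ys x y t : (t <= size xs)%N -> (t <= size ys)%N ->
  state s1 (rcons xs x) (rcons ys y) t = state s1 xs ys t.
Proof.
by move=> hx hy; apply: eq_state => i it; rewrite nth_rcons_lt // (leq_trans it).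
Qed.

Lemma eq_mkseq_lt (Z : Type) (f g : nat -> Z) n : (forall i, (i < n)%N -> f i = g i) ->
  mkseq f n = mkseq g n.
Proof.
by move=> fg; apply/eq_in_map => i; rewrite mem_iota => /andP[_ h]; exact: fg.
Qed.

Lemma traj_rcons T s1 xs ys x y : size xs = T -> size ys = T ->
  traj T.+1 s1 (rcons xs x) (rcons ys y) = traj T s1 xs ys * arrival (rcons xs x) T *
    q T (rcons xs x) (mkseq (state s1 xs ys) T.+1) ys y.
Proof.
move=> hx hy; rewrite /traj big_ord_recr /= !mulrA; congr (_ * _ * _).
  congr (_ * _); apply: eq_bigr => -[t tT] _ /=; congr (_ * q t _ _ _ _).
  - by case: t tT => [|t] tT /=; rewrite !nth_rcons_lt // ?hx // ltnW.
  - by rewrite take_rcons_le ?hx.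
  - by apply: eq_mkseq_lt => i it; rewrite state_rcons ?hx ?hy //; lia.
  - by rewrite take_rcons_le ?hy // ltnW.
  - by rewrite nth_rcons_lt ?hy.
congr (q T _ _ _ _).
- by rewrite take_oversize // size_rcons hx.
- by apply: eq_mkseq_lt => i it; rewrite state_rcons ?hx ?hy //; lia.
- by rewrite -cats1 takel_cat ?hy // take_oversize ?hy.
- by rewrite nth_rcons hy ltnn eqxx.
Qed.

Hypothesis qv : valid_policy q.

Lemma policy_ge0 t xs ss ys y : size xs = t.+1 -> size ss = t.+1 -> size ys = t ->
  0 <= q t xs ss ys y.
Proof. by move=> h1 h2 h3; case: (qv h1 h2 h3). Qed.

Lemma policy_sum1 t xs ss ys : size xs = t.+1 -> size ss = t.+1 -> size ys = t ->
  \sum_y q t xs ss ys y = 1.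
Proof. by move=> h1 h2 h3; case: (qv h1 h2 h3) => _ []. Qed.

Lemma policy_feasible t xs ss ys y : size xs = t.+1 -> size ss = t.+1 -> size ys = t ->
  q t xs ss ys y != 0 -> feasible ms (nth ord0 ss t) (nth ord0 xs t) y.
Proof.
move=> h1 h2 h3 qn; have [q0 [q1 q2]] := qv h1 h2 h3.
apply: contraT => nf.
have : \sum_(y' : Y | ~~ feasible ms (nth ord0 ss t) (nth ord0 xs t) y') q t xs ss ys y' = 0.
  move: q1; rewrite (bigID (fun y' : Y => feasible ms (nth ord0 ss t) (nth ord0 xs t) y')) /= q2.
  by move/(canRL (addKr _)); rewrite addNr.
move/psumr_eq0P => /(_ (fun y' _ => q0 y')) /(_ y nf) e.
by rewrite e eqxx in qn.
Qed.

Lemma state_step s1 xs ys t :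
  feasible ms (state s1 xs ys t) (nth ord0 xs t) (nth ord0 ys t) ->
  (state s1 xs ys t.+1 + nth ord0 xs t = state s1 xs ys t + nth ord0 ys t)%N.
Proof. by rewrite /feasible => /= h; rewrite inordK; lia. Qed.

Lemma jointP_recr T xs ss ys : jointP Q PX1 PS1 q T.+1 xs ss ys =
  jointP Q PX1 PS1 q T xs ss ys *
  ((if T == 0%N then PS1 (nth ord0 ss 0) * PX1 (nth ord0 xs 0)
    else ((nth ord0 ss T + nth ord0 xs T.-1 == nth ord0 ss T.-1 + nth ord0 ys T.-1)%N)%:R
         * Q (nth ord0 xs T.-1) (nth ord0 xs T))
   * q T (take T.+1 xs) (take T.+1 ss) (take T ys) (nth ord0 ys T)).
Proof. by rewrite /jointP big_ord_recr. Qed.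

Lemma traj_recr T s1 xs ys : traj T.+1 s1 xs ys = traj T s1 xs ys * (arrival xs T *
    q T (take T.+1 xs) (mkseq (state s1 xs ys) T.+1) (take T ys) (nth ord0 ys T)).
Proof. by rewrite /traj big_ord_recr /= [LHS]mulrA. Qed.

Lemma take_mkseq (Z : Type) (f : nat -> Z) i n : (i <= n)%N -> take i (mkseq f n) = mkseq f i.
Proof. by move=> h; rewrite /mkseq -map_take take_iota; move/minn_idPl: h => ->. Qed.

Lemma jointP_state N s1 xs ys T : (0 < T <= N)%N -> size xs = N -> size ys = N ->
  jointP Q PX1 PS1 q T xs (mkseq (state s1 xs ys) N) ys = traj T s1 xs ys.
Proof.
move=> TN hx hy; elim: T TN => // T IH TN; rewrite jointP_recr traj_recr.
rewrite take_mkseq; last by lia.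
case: T IH TN => [_|T IH] TN.
  rewrite /jointP big_ord0 mul1r /= /traj big_ord0 mulr1 !nth_mkseq; last by lia.
  by rewrite /= !mulrA.
rewrite IH; last by lia.
(* On a trajectory of positive probability the last letter was feasible, so [inord] in [state] gives
   the true next charge. *)
have [->|tn] := eqVneq (traj T.+1 s1 xs ys) 0; first by rewrite !mul0r.
congr (_ * (_ * _)) => /=; rewrite !nth_mkseq; try lia.
suff -> : (state s1 xs ys T.+1 + nth ord0 xs T == state s1 xs ys T + nth ord0 ys T)%N.
  by rewrite mul1r.
apply/eqP/state_step.
move: tn; rewrite traj_recr !mulf_eq0 !negb_or => /andP[_ /andP[_ /policy_feasible]].
rewrite size_takel ?hx; last by lia.
rewrite size_mkseq size_takel ?hy; last by lia.
move=> /(_ erefl erefl erefl); by rewrite nth_mkseq // nth_take.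
Qed.

Lemma jointP_support N s1 xs ss ys T : (T <= N)%N -> size xs = N -> size ys = N -> size ss = N ->
  nth ord0 ss 0 = s1 -> jointP Q PX1 PS1 q T xs ss ys != 0 ->
  forall i, (i < T)%N -> nth ord0 ss i = state s1 xs ys i.
Proof.
move=> TN hx hy hs s0; elim: T TN => // T IH TN.
rewrite jointP_recr mulf_eq0 negb_or => /andP[jn fn] i.
rewrite ltnS leq_eqVlt => /predU1P[->|iT]; last by apply: IH => //; lia.
case: T IH TN jn fn => [|T] IH TN jn fn; first exact: s0.
have Hi j : (j < T.+1)%N -> nth ord0 ss j = state s1 xs ys j by apply: IH => //; lia.
move: fn; rewrite !mulf_eq0 !negb_or /= => /andP[/andP[/[dup] en _ _] _].
have {en} e : (nth ord0 ss T.+1 + nth ord0 xs T = nth ord0 ss T + nth ord0 ys T)%N.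
  by apply/eqP; apply: contraNT en => /negbTE ->; rewrite eqxx.
apply/val_inj => /=; rewrite inordK -Hi //; first by lia.
by have := ltn_ord (nth ord0 ss T.+1); lia.
Qed.

(** The initial charge, the demands and the letters determine the charge path, so one term of the
    sum survives. For [T = 0] the empty product would lack the factor [PS1]. *)
Lemma jointXS1Y_traj T (a : T.-tuple X * S) (ys : T.-tuple Y) : (0 < T)%N ->
  jointXS1Y Q PX1 PS1 q a ys = traj T a.2 a.1 ys.
Proof.
move=> T0; case: a => xs s1; rewrite /jointXS1Y /=.
pose ss0 : T.-tuple S := [tuple of mkseq (state s1 xs ys) T].
rewrite (bigD1 ss0) /=; last by rewrite nth_mkseq.
rewrite big1 ?addr0 => [|ss /andP[/eqP e0 ne]].
  by rewrite jointP_state ?size_tuple // T0 leqnn.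
apply/eqP; apply: contraNT ne => jn; apply/eqP/val_inj => /=.
apply: (@eq_from_nth _ ord0); first by rewrite size_mkseq size_tuple.
move=> i; rewrite size_tuple => iT.
by rewrite nth_mkseq // (jointP_support (leqnn T) _ _ _ e0 jn) ?size_tuple.
Qed.

End Trajectories.

(** * Belief recursion and information gain under a policy *)

Section Dynamics.
Variables (R : realType) (mx my ms : nat) (Q : 'M[R]_mx.+1).
Local Notation X := 'I_mx.+1.
Local Notation Y := 'I_my.+1.
Local Notation S := 'I_ms.+1.
Variables (PX1 : X -> R) (PS1 : S -> R) (q : policy R mx my ms).
Hypotheses (stoQ : stochastic Q) (pmfX : is_pmf PX1) (pmfS : is_pmf PS1)
  (qv : valid_policy q).

Section AtTime.
Variable T : nat.
Local Notation A := (T.-tuple X * S)%type.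
Local Notation B := (T.-tuple Y).

Definition law (a : A) (b : B) : R := traj Q PX1 PS1 q T a.2 a.1 b.
Definition arrival_law (a : A) (x : X) : R := arrival Q PX1 (rcons a.1 x) T.
Definition letter_law (a : A) (b : B) (x : X) (y : Y) : R :=
  q T (rcons a.1 x) (mkseq (state a.2 a.1 b) T.+1) b y.
Definition charge_at (a : A) (b : B) : S := state a.2 a.1 b T.

Lemma arrival_ge0 xs t : 0 <= arrival Q PX1 xs t.
Proof. by case: t => [|t] /=; [case: pmfX | exact: sto_ge0]. Qed.

Lemma arrival_law_ge0 a x : 0 <= arrival_law a x. Proof. exact: arrival_ge0. Qed.

Lemma arrival_law_sum1 a : \sum_x arrival_law a x = 1.
Proof.
case: a => xs s1; rewrite /arrival_law /=.
have nT x : nth ord0 (rcons xs x) T = x by rewrite nth_rcons size_tuple ltnn eqxx.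
rewrite /arrival; case: T xs nT => [|T'] xs nT.
  by under eq_bigr => x _ do rewrite nT; case: pmfX.
under eq_bigr => x _ do rewrite nT nth_rcons_lt ?size_tuple //.
exact: sto_sum.
Qed.

Lemma letter_law_ge0 a b x y : 0 <= letter_law a b x y.
Proof. by apply: (policy_ge0 qv); rewrite ?size_rcons ?size_tuple ?size_mkseq. Qed.

Lemma letter_law_sum1 a b x : \sum_y letter_law a b x y = 1.
Proof. by apply: (policy_sum1 qv); rewrite ?size_rcons ?size_tuple ?size_mkseq. Qed.

Lemma letter_law_feasible a b x y : letter_law a b x y != 0 ->
  feasible ms (charge_at a b) x y.
Proof.
move=> /(policy_feasible qv); rewrite size_rcons size_tuple size_mkseq size_tuple.
move=> /(_ erefl erefl erefl); rewrite nth_mkseq //.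
by rewrite nth_rcons size_tuple ltnn eqxx.
Qed.

Lemma law_ge0 a b : 0 <= law a b.
Proof.
apply: mulr_ge0; first by case: pmfS.
apply: prodr_ge0 => t _; rewrite mulr_ge0 ?arrival_ge0 //.
have tT := ltn_ord t.
by apply: (policy_ge0 qv); rewrite ?size_mkseq // size_takel ?size_tuple // ltnW.
Qed.

Definition outm := out_mass law.
Definition statem := state_mass law arrival_law charge_at.
Definition fullm := full_mass law arrival_law letter_law charge_at.
Definition nextm := next_mass law arrival_law letter_law charge_at.
Definition gain := info_gain law arrival_law letter_law charge_at.

Definition belief_of (b : B) : X -> S -> R := fun x s => statem b x s / outm b.

Definition MI_law := MI law.

Lemma outm_ge0 b : 0 <= outm b.
Proof. apply: out_mass_ge0; exact: law_ge0. Qed.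

Lemma statem_ge0 b x s : 0 <= statem b x s.
Proof. by apply: state_mass_ge0; [exact: law_ge0 | exact: arrival_law_ge0]. Qed.

Lemma nextm_ge0 b y : 0 <= nextm b y.
Proof.
by apply: next_mass_ge0; [exact: law_ge0 | exact: arrival_law_ge0 | exact: letter_law_ge0].
Qed.

Lemma sum_nextm b : \sum_y nextm b y = outm b.
Proof. by apply: sum_next_mass; [exact: arrival_law_sum1 | exact: letter_law_sum1]. Qed.

Lemma sum_statem b : \sum_x \sum_s statem b x s = outm b.
Proof.
by apply: (@sum_state_mass1 _ _ _ _ _ _ law arrival_law letter_law charge_at); [exact: arrival_law_sum1 | exact: letter_law_sum1].
Qed.

Lemma nextm_neq0 b y : nextm b y != 0 -> outm b != 0.
Proof.
move=> nn; rewrite gt_eqF // -sum_nextm (bigD1 y) //= ltr_wpDr //.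
  by apply: sumr_ge0 => i _; exact: nextm_ge0.
by rewrite lt0r nn nextm_ge0.
Qed.

Lemma belief_of_pmf b : outm b != 0 -> is_pmfXS (belief_of b).
Proof.
move=> on; split=> [x s|]; first by rewrite divr_ge0 ?statem_ge0 // outm_ge0.
under eq_bigr => x _ do rewrite -mulr_suml.
rewrite -mulr_suml sum_statem.
exact: divff.
Qed.

Lemma fullm_feasible b x s y : fullm b x s y != 0 -> feasible ms s x y.
Proof.
move=> fn; apply: contrapT => nf; move/eqP: fn; apply.
apply: big1 => a /eqP e; have [->|ln] := eqVneq (letter_law a b x y) 0; first by rewrite mulr0.
by exfalso; apply: nf; rewrite -e; exact: letter_law_feasible ln.
Qed.

Lemma fullm_ge0 b x s y : 0 <= fullm b x s y.
Proof.
by apply: full_mass_ge0; [exact: law_ge0 | exact: arrival_law_ge0 | exact: letter_law_ge0].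
Qed.

Lemma sum_fullm b x s : \sum_y fullm b x s y = statem b x s.
Proof. apply: sum_full_mass; exact: letter_law_sum1. Qed.

Lemma fullm_act (act : B -> X -> S -> Y -> R) :
  (forall a b x y, letter_law a b x y = act b x (charge_at a b) y) ->
  forall b x s y, fullm b x s y = statem b x s * act b x s y.
Proof.
move=> lE b x s y; rewrite /fullm /full_mass /statem /state_mass mulr_suml.
by apply: eq_bigr => a /eqP e; rewrite lE e.
Qed.

Section Action.
Variable act : B -> X -> S -> Y -> R.
Hypothesis actE : forall b x s y, fullm b x s y = statem b x s * act b x s y.

Lemma kernel_beliefE b x s y :
  kernel_at (act b) y x s * belief_of b x s = (outm b)^-1 * fullm b x s y.
Proof. by rewrite /kernel_at /belief_of actE; ring. Qed.

Lemma mass_act b y : mass (kernel_at (act b) y) (belief_of b) = nextm b y / outm b.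
Proof.
rewrite /nextm /next_mass mulr_suml; apply: eq_bigr => x _.
rewrite mulr_suml; apply: eq_bigr => s _.
by rewrite kernel_beliefE mulrC.
Qed.

Lemma gainE : (forall b, outm b != 0 -> admissible (act b)) ->
  gain = \sum_b outm b * Iact (act b) (belief_of b).
Proof.
move=> aa; rewrite /gain /info_gain -/fullm -/statem -/nextm -/outm.
apply: eq_bigr => b _; have [z0|on] := eqVneq (outm b) 0.
  rewrite z0 mul0r big1 // => x _; rewrite big1 // => s _; rewrite big1 // => y _.
  suff -> : fullm b x s y = 0 by rewrite mul0r.
  apply/le_anti; rewrite fullm_ge0 andbT.
  apply: (@le_trans _ _ (statem b x s)).
    by rewrite -sum_fullm (bigD1 y) //= lerDl sumr_ge0 // => i _; exact: fullm_ge0.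
  rewrite -z0 -[leRHS]sum_statem.
  rewrite (bigD1 x) //= (bigD1 s) //= -addrA lerDl addr_ge0 //.
    by apply: sumr_ge0 => i _; exact: statem_ge0.
  by apply: sumr_ge0 => i _; apply: sumr_ge0 => j _; exact: statem_ge0.
rewrite /Iact MIE mulr_sumr -sum_pair; apply: eq_bigr => -[x s] _ /=.
rewrite mulr_sumr; apply: eq_bigr => y _.
have beE x' s' y' : belief_of b x' s' * act b x' s' y' = fullm b x' s' y' / outm b.
  by rewrite mulrC -[act b x' s' y']/(kernel_at (act b) y' x' s') kernel_beliefE mulrC.
have -> : \sum_b' belief_of b x s * act b x s b' = statem b x s / outm b.
  by under eq_bigr => y' _ do rewrite beE; rewrite -mulr_suml sum_fullm.
have -> : \sum_(a' : X * S) belief_of b a'.1 a'.2 * act b a'.1 a'.2 y = nextm b y / outm b.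
  rewrite (sum_pair (fun x s => belief_of b x s * act b x s y)) -mass_act.
  by apply: eq_bigr => ? _; apply: eq_bigr => ? _; rewrite mulrC.
rewrite beE [RHS]mulrA [outm b * _]mulrC divfK //; congr (_ * ln _).
have [f0|fn] := eqVneq (fullm b x s y) 0; first by rewrite f0 !mul0r.
have fp : 0 < fullm b x s y by rewrite lt0r fn fullm_ge0.
have sn : statem b x s != 0.
  rewrite gt_eqF // -sum_fullm (bigD1 y) //= ltr_wpDr // sumr_ge0 // => i _; exact: fullm_ge0.
have nn : nextm b y != 0.
  rewrite gt_eqF // /nextm /next_mass (bigD1 x) //= (bigD1 s) //= -addrA ltr_wpDr //.
  rewrite addr_ge0 //; first by apply: sumr_ge0 => i _; exact: fullm_ge0.
  by apply: sumr_ge0 => i _; apply: sumr_ge0 => j _; exact: fullm_ge0.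
by field; rewrite on sn nn.
Qed.

End Action.

End AtTime.

Lemma lawS T (a : T.-tuple X * S) (x : X) (b : T.-tuple Y) (y : Y) :
  @law T.+1 (rcons_tuple a.1 x, a.2) (rcons_tuple b y) =
  law a b * arrival_law a x * letter_law a b x y.
Proof. by rewrite /law /= traj_rcons ?size_tuple. Qed.

Lemma MI_lawS T : MI_law T.+1 = MI (extend (@law T) (@arrival_law T) (@letter_law T)).
Proof.
rewrite /MI_law (MI_reindex _ (rcons_pair_bij X S T) (rcons_tuple_bij Y T)).
congr MI; apply/funext => -[[xs s] x]; apply/funext => -[ys y] /=.
by rewrite -[xs in LHS]/((xs, s).1) -[s in LHS]/((xs, s).2) lawS.
Qed.

Lemma MI_law_ge T : MI_law T + gain T <= MI_law T.+1.
Proof.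
rewrite MI_lawS; apply: MI_extend_ge.
- exact: law_ge0.
- exact: arrival_law_ge0.
- exact: letter_law_ge0.
- exact: arrival_law_sum1.
- exact: letter_law_sum1.
Qed.

Lemma outmS T (b : T.-tuple Y) y : outm (rcons_tuple b y) = nextm b y.
Proof.
rewrite /nextm next_massE /outm /out_mass.
rewrite (reindex (fun a : (T.-tuple X * S) * X => (rcons_tuple a.1.1 a.2, a.1.2))) /=; last first.
  by apply: onW_bij; exact: rcons_pair_bij.
rewrite -sum_pair; apply: eq_bigr => -[a x] _ /=; exact: lawS.
Qed.

Lemma statemS T (b : T.-tuple Y) (y : Y) x' (s' : S) :
  statem (rcons_tuple b y) x' s' =
  \sum_(x : X) \sum_(s : S | (s + y == s' + x)%N) Q x x' * fullm b x s y.
Proof.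
rewrite /statem /state_mass.
rewrite (reindex (fun a : (T.-tuple X * S) * X => (rcons_tuple a.1.1 a.2, a.1.2))) /=; last first.
  by apply: onW_bij; exact: rcons_pair_bij.
have nxt (a : T.-tuple X * S) (x : X) :
    charge_at (rcons_tuple a.1 x, a.2) (rcons_tuple b y) = inord (charge_at a b + y - x).
  rewrite /charge_at /= state_rcons ?size_tuple // !nth_rcons !size_tuple ltnn eqxx.
  by [].
have arr (a : T.-tuple X * S) (x : X) : Q (nth ord0 (rcons (rcons a.1 x) x') T)
    (nth ord0 (rcons (rcons a.1 x) x') T.+1) = Q x x'.
  rewrite !nth_rcons !size_rcons !size_tuple ltnS leqnn ltnn eqxx.
  by rewrite !ltnn !eqxx.
rewrite big_mkcond /=.
rewrite (sum_pair (fun a x => if charge_at (rcons_tuple a.1 x, a.2) (rcons_tuple b y) == s'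
  then law (rcons_tuple a.1 x, a.2) (rcons_tuple b y)
       * arrival_law (rcons_tuple a.1 x, a.2) x' else 0)) /=.
rewrite exchange_big /=; apply: eq_bigr => x _.
rewrite [RHS]big_mkcond /=.
rewrite [LHS](partition_big (fun a => charge_at a b) predT) //=; apply: eq_bigr => s _.
(* An infeasible letter has probability 0; for a feasible one [inord] is exact. *)
have [fs|nfs] := boolP (feasible ms s x y); last first.
  rewrite big1 => [|a /eqP es].
    case: ifP => // _; have [->|fn] := eqVneq (fullm b x s y) 0; first by rewrite mulr0.
    by rewrite (fullm_feasible fn) in nfs.
  case: ifP => // _; rewrite lawS.
  have [->|ln] := eqVneq (letter_law a b x y) 0; first by rewrite mulr0 mul0r.
  by rewrite -es (letter_law_feasible ln) in nfs.
have cE : (inord (s + y - x) == s') = (s + y == s' + x)%N.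
  rewrite -val_eqE /= inordK; move: fs; rewrite /feasible; lia.
under eq_bigr => a /eqP es do rewrite nxt es cE.
case: ifP => _; last by rewrite big1.
rewrite /fullm /full_mass mulr_sumr; apply: eq_bigr => a _.
by rewrite lawS arr mulrC.
Qed.

Lemma belief_ofS T (act : T.-tuple Y -> X -> S -> Y -> R) :
  (forall b x s y, fullm b x s y = statem b x s * act b x s y) ->
  forall b y, nextm b y != 0 ->
  belief_of (rcons_tuple b y) = post Q (belief_of b) y (kernel_at (act b) y).
Proof.
move=> actE b y nn; have on := nextm_neq0 nn.
apply/funext => x'; apply/funext => s'; rewrite /post (mass_act actE).
have -> : push Q (kernel_at (act b) y) (belief_of b) y x' s' =
    statem (rcons_tuple b y) x' s' / outm b.
  rewrite statemS mulr_suml; apply: eq_bigr => x _; rewrite mulr_suml; apply: eq_bigr => s _.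
  by rewrite -mulrA (kernel_beliefE actE); ring.
rewrite /belief_of outmS; by field; rewrite on nn.
Qed.

Lemma belief_of0 (b : 0.-tuple Y) : outm b = 1 /\ belief_of b = (fun x s => PX1 x * PS1 s).
Proof.
have sum0 (F : 0.-tuple X * S -> R) : \sum_a F a = \sum_s F ([tuple], s).
  rewrite (reindex (fun s : S => ([tuple] : 0.-tuple X, s))) //=.
  by exists snd => [s|[xs s]] //= _; rewrite (tuple0 xs).
have lE s : law ([tuple], s) b = PS1 s by rewrite /law /traj big_ord0 mulr1.
have oE : outm b = 1.
  rewrite /outm /out_mass sum0; under eq_bigr => s _ do rewrite lE.
  by case: pmfS.
split=> //; apply/funext => x; apply/funext => s; rewrite /belief_of oE divr1.
rewrite /statem /state_mass big_mkcond sum0 /= (bigD1 s) //=.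
have cE s2 : charge_at ([tuple], s2) b = s2 by [].
rewrite cE (eqxx s) big1 ?addr0 => [|s2 /negbTE sn]; first by rewrite lE mulrC.
by rewrite cE sn.
Qed.

Lemma MI_law0 : MI_law 0 = 0.
Proof.
rewrite /MI_law MIE big1 // => a _; rewrite big1 // => b _.
have -> : \sum_b' law a b' = law a b.
  by rewrite (big_pred1 b) // => b'; rewrite (tuple0 b) (tuple0 b') /= (eqxx [tuple]).
have -> : \sum_a' law a' b = 1 by case: (belief_of0 b).
rewrite mulr1; have [->|ln] := eqVneq (law a b) 0; first by rewrite mul0r.
by rewrite divff // ln1 mulr0.
Qed.

Lemma sum_outm T : \sum_(b : T.-tuple Y) outm b = 1.
Proof.
elim: T => [|T IH].
  rewrite (big_pred1 [tuple]); first by case: (belief_of0 [tuple]).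
  by move=> b; rewrite (tuple0 b) /= (eqxx [tuple]).
rewrite (reindex (fun b : T.-tuple Y * Y => rcons_tuple b.1 b.2)) /=; last first.
  by apply: onW_bij; exact: rcons_tuple_bij.
rewrite (sum_pair (fun b y => outm (rcons_tuple b y))) -[RHS]IH; apply: eq_bigr => b _.
by under eq_bigr => y _ do rewrite outmS; rewrite sum_nextm.
Qed.

Lemma leakT_MI_law T : (0 < T)%N -> leakT Q PX1 PS1 q T = MI_law T / T%:R.
Proof.
move=> T0; rewrite /leakT /MI_law; congr (MI _ / _).
apply/funext => a; apply/funext => b; exact: jointXS1Y_traj.
Qed.

End Dynamics.

(** * Optimality *)

Section Limsup.
Variable R : realType.
Local Open Scope classical_set_scope.

Lemma natr_inv_small (c e : R) : 0 < e -> exists n, forall T, (n < T)%N -> c / T%:R <= e.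
Proof.
move=> e0; exists (Num.truncn (`|c| / e)).+1 => T nT.
have T0 : 0 < T%:R :> R by rewrite ltr0n; lia.
rewrite ler_pdivrMr // (le_trans (ler_norm c)) // mulrC -ler_pdivrMr //.
apply: ltW; apply: (lt_le_trans (Num.Theory.truncnS_gt _)); rewrite ler_nat; exact: ltnW.
Qed.

Lemma limn_esup_le_rate (u : nat -> R) (J c : R) :
  (forall T, (0 < T)%N -> u T <= J + c / T%:R) -> (limn_esup (fun T => (u T)%:E) <= J%:E)%E.
Proof.
move=> H; apply/lee_addgt0Pr => e e0; have [n Hn] := natr_inv_small c e0.
apply: (@le_trans _ _ (ereal_sup ((fun T => (u T)%:E) @` [set T | (n < T)%N]))).
  by apply: ereal_inf_lbound; exists [set T | (n < T)%N] => //; exists n.+1.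
apply: ge_ereal_sup => _ [T /= nT <-]; rewrite -EFinD lee_fin.
by apply: (le_trans (H T _)); [lia | rewrite lerD2l; exact: Hn].
Qed.

Lemma limn_esup_ge_rate (u : nat -> R) (J c : R) :
  (forall T, (0 < T)%N -> J - c / T%:R <= u T) -> (J%:E <= limn_esup (fun T => (u T)%:E))%E.
Proof.
move=> H; apply/lee_addgt0Pr => e e0; have [n Hn] := natr_inv_small c e0.
rewrite -leeBlDr //; apply: le_ereal_inf_tmp => _ [V [N _ NV] <-].
pose T := (maxn N n).+1.
apply: (@le_trans _ _ (u T)%:E); last first.
  by apply: ereal_sup_ubound; exists T => //; apply: NV; rewrite /= /T; lia.
rewrite -EFinB lee_fin; apply: le_trans (H T _); last by rewrite /T; lia.
by rewrite lerD2l lerN2; apply: Hn; rewrite /T; lia.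
Qed.

End Limsup.

(** * From the optimality equation to the leakage rate *)

Section Optimality.
Variables (R : realType) (mx my ms : nat) (Q : 'M[R]_mx.+1).
Local Notation X := 'I_mx.+1.
Local Notation Y := 'I_my.+1.
Local Notation S := 'I_ms.+1.
Variables (PX1 : X -> R) (PS1 : S -> R).
Variable phi0 : (X -> S -> R) -> Y -> (X -> S -> Y -> R) -> X -> S -> R.
Variables (J : R) (v : (X -> S -> R) -> R) (f : (X -> S -> R) -> X -> S -> Y -> R).
Hypotheses (le_mx_my : (mx <= my)%N) (stoQ : stochastic Q).
Hypotheses (pmfX : is_pmf PX1) (pmfS : is_pmf PS1).
Hypothesis phi0_pmf : forall p y a, is_pmfXS (phi0 p y a).
Hypothesis acoe : forall p, is_pmfXS p ->
  admissible (f p) /\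
  (forall a, admissible a -> bellman Q phi0 (f p) v p <= bellman Q phi0 a v p) /\
  J + v p = bellman Q phi0 (f p) v p.

Local Notation start := (fun (x : X) (s : S) => PX1 x * PS1 s).

Lemma start_pmf : is_pmfXS start.
Proof.
have [x0 x1] := pmfX; have [s0 s1] := pmfS; split=> [x s|]; first by rewrite mulr_ge0.
by under eq_bigr => x _ do rewrite -mulr_sumr s1 mulr1.
Qed.

Lemma Iact_le (a : X -> S -> Y -> R) p : admissible a -> is_pmfXS p ->
  Iact a p <= #|{: X * S}|%:R.
Proof.
move=> aa [p0 _]; apply: MI_le_card => xs y.
by rewrite mulr_ge0 //; case: (aa xs.1 xs.2).
Qed.

Lemma acoe_value_le p (a : X -> S -> Y -> R) : is_pmfXS p -> admissible a ->
  v p <= `|J| + #|{: X * S}|%:R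
         + \sum_y mass (kernel_at a y) p * v (post Q p y (kernel_at a y)).
Proof.
move=> pp aa; have [_ [/(_ a aa) + eJ]] := acoe pp.
rewrite -eJ bellman_postE; have := Iact_le aa pp; have := oppr_norm_le J.
set E := \sum_y _; lra.
Qed.

Lemma belief_pmf ys : is_pmfXS (belief Q PX1 PS1 phi0 f ys).
Proof.
elim/last_ind: ys => [|ys y IH]; first exact: start_pmf.
rewrite /belief foldl_rcons -/(belief Q PX1 PS1 phi0 f ys).
set p := belief _ _ _ _ _ _ in IH *.
have [aa _] := acoe IH.
have [m0|mn] := eqVneq (mass (kernel_at (f p) y) p) 0.
  by rewrite /filt -/(mass (kernel_at (f p) y) p) m0 eqxx.
have a0 x s : 0 <= kernel_at (f p) y x s by rewrite /kernel_at; case: (aa x s).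
rewrite filtE //; apply: pmf_post => //.
  by move=> x s; apply: (admissible_feasible aa).
by rewrite lt0r mn mass_ge0 //; case: IH.
Qed.

Local Notation qstar := (belief_policy Q PX1 PS1 phi0 f).

Lemma belief_policy_valid : valid_policy qstar.
Proof.
move=> t xs ss ys _ _ _; have [aa _] := acoe (belief_pmf ys).
exact: (aa (nth ord0 xs t) (nth ord0 ss t)).
Qed.

Section Policy.
Variables (q : policy R mx my ms) (qv : valid_policy q).
Local Notation outm T := (@outm R mx my ms Q PX1 PS1 q T).
Local Notation statem T := (@statem R mx my ms Q PX1 PS1 q T).
Local Notation fullm T := (@fullm R mx my ms Q PX1 PS1 q T).
Local Notation nextm T := (@nextm R mx my ms Q PX1 PS1 q T).
Local Notation belief_of T := (@belief_of R mx my ms Q PX1 PS1 q T).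
Local Notation MI_law := (@MI_law R mx my ms Q PX1 PS1 q).
Local Notation gain := (@gain R mx my ms Q PX1 PS1 q).

Definition mean_value T : R := \sum_(b : T.-tuple Y) outm T b * v (belief_of T b).

Lemma mean_value0 : mean_value 0 = v start.
Proof.
rewrite /mean_value (big_pred1 [tuple]) => [|b]; last by rewrite (tuple0 b) /= (eqxx [tuple]).
by have [-> ->] := belief_of0 Q PX1 q pmfS [tuple]; rewrite mul1r.
Qed.

Lemma mean_value_step T (act : T.-tuple Y -> X -> S -> Y -> R) :
  (forall b x s y, fullm T b x s y = statem T b x s * act b x s y) ->
  (forall b, outm T b != 0 -> admissible (act b)) ->
  gain T + mean_value T.+1 =
  \sum_b outm T b * bellman Q phi0 (act b) v (belief_of T b).
Proof.
move=> actE aa; rewrite (gainE stoQ pmfX pmfS qv actE aa).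
rewrite {1}/mean_value (reindex (fun b : T.-tuple Y * Y => rcons_tuple b.1 b.2)) /=; last first.
  by apply: onW_bij; exact: rcons_tuple_bij.
rewrite (sum_pair (fun b y => outm T.+1 (rcons_tuple b y) * v (belief_of T.+1 (rcons_tuple b y)))).
rewrite -big_split /=; apply: eq_bigr => b _.
rewrite bellman_postE mulrDr mulr_sumr; congr (_ + _); apply: eq_bigr => y _.
rewrite outmS (mass_act actE).
have [->|nn] := eqVneq (nextm T b y) 0; first by rewrite !mul0r mulr0.
rewrite (belief_ofS stoQ pmfX pmfS qv actE nn) mulrA [outm T b * _]mulrC divfK //.
exact: (nextm_neq0 stoQ pmfX pmfS qv nn).
Qed.

Lemma sum_outm_acoe T : \sum_b outm T b * (J + v (belief_of T b)) = J + mean_value T.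
Proof.
under eq_bigr => b _ do rewrite mulrDr.
by rewrite big_split /= -mulr_suml (sum_outm stoQ pmfX pmfS qv) mul1r.
Qed.

Lemma mean_value_le T : J + mean_value T <= gain T + mean_value T.+1.
Proof.
(* The conditional law of the letter given the past letters and the state, which averages out the
   remaining history. At states of probability 0 holding the charge keeps the action admissible. *)
pose act (b : T.-tuple Y) x s y : R := if statem T b x s == 0
  then det_action R (@hold_letter mx my ms) x s y else fullm T b x s y / statem T b x s.
have f0 b x s y := fullm_ge0 stoQ pmfX pmfS qv b x s y.
have actE b x s y : fullm T b x s y = statem T b x s * act b x s y.
  rewrite /act; have [e|sn] := eqVneq (statem T b x s) 0; last by rewrite mulrC divfK.
  rewrite e mul0r; apply/le_anti; rewrite f0 andbT -[leRHS]e -(sum_fullm Q PX1 PS1 qv).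
  by rewrite (bigD1 y) //= lerDl sumr_ge0.
have hd : admissible (det_action R (@hold_letter mx my ms)).
  by apply: det_action_admissible => x s; exact: hold_feasible.
have aa b : admissible (act b).
  move=> x s; rewrite /act; have [e|sn] := eqVneq (statem T b x s) 0.
    exact: (hd x s).
  have s0 : 0 <= statem T b x s by exact: (statem_ge0 stoQ pmfX pmfS qv).
  have sum1 : \sum_y fullm T b x s y / statem T b x s = 1.
    by rewrite -mulr_suml (sum_fullm Q PX1 PS1 qv) divff.
  split; first by move=> y; rewrite divr_ge0.
  split=> //; rewrite -[RHS]sum1 big_mkcond /=; apply: eq_bigr => y _.
  case: ifP => // /negbT nf; suff -> : fullm T b x s y = 0 by rewrite mul0r.
  by apply/eqP; apply: contraNT nf => /(fullm_feasible qv).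
rewrite (mean_value_step actE (fun b _ => aa b)) -sum_outm_acoe; apply: ler_sum => b _.
have [->|on] := eqVneq (outm T b) 0; first by rewrite !mul0r.
rewrite ler_wpM2l //; first exact: (outm_ge0 stoQ pmfX pmfS qv).
have [_ [opt ->]] := acoe (belief_of_pmf stoQ pmfX pmfS qv on).
exact: opt.
Qed.

Lemma MI_law_ge_value T : J * T%:R + v start <= MI_law T + mean_value T.
Proof.
elim: T => [|T IH]; first by rewrite mulr0 add0r (MI_law0 Q PX1 q pmfS) mean_value0 add0r.
have := MI_law_ge stoQ pmfX pmfS qv T; have := mean_value_le T; move: IH.
rewrite -natr1 mulrDr mulr1; lra.
Qed.

Lemma leakInf_ge B : (forall p, is_pmfXS p -> v p <= B) -> (J%:E <= leakInf Q PX1 PS1 q)%E.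
Proof.
move=> UB; apply: (@limn_esup_ge_rate _ _ _ (B - v start)) => T T0.
have Tp : 0 < T%:R :> R by rewrite ltr0n.
rewrite (leakT_MI_law Q PX1 PS1 qv T0) ler_pdivlMr // mulrBl divfK ?gt_eqF //.
have EB : mean_value T <= B.
  rewrite -[leRHS]mul1r -(sum_outm stoQ pmfX pmfS qv T) mulr_suml; apply: ler_sum => b _.
  have [->|on] := eqVneq (outm T b) 0; first by rewrite !mul0r.
  rewrite ler_wpM2l //; first exact: (outm_ge0 stoQ pmfX pmfS qv).
  by apply: UB; exact: (belief_of_pmf stoQ pmfX pmfS qv on).
have := MI_law_ge_value T; lra.
Qed.

End Policy.

Section OptimalPolicy.
Let qv := belief_policy_valid.
Local Notation outm T := (@outm R mx my ms Q PX1 PS1 qstar T).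
Local Notation statem T := (@statem R mx my ms Q PX1 PS1 qstar T).
Local Notation fullm T := (@fullm R mx my ms Q PX1 PS1 qstar T).
Local Notation nextm T := (@nextm R mx my ms Q PX1 PS1 qstar T).
Local Notation belief_of T := (@belief_of R mx my ms Q PX1 PS1 qstar T).
Local Notation MI_law := (@MI_law R mx my ms Q PX1 PS1 qstar).
Local Notation gain := (@gain R mx my ms Q PX1 PS1 qstar).

Let act T (b : T.-tuple Y) := f (belief Q PX1 PS1 phi0 f b).

Let act_adm T (b : T.-tuple Y) : admissible (act b).
Proof. by have [] := acoe (belief_pmf b). Qed.

Lemma letter_law_qstar T (a : T.-tuple X * S) b x y :
  letter_law qstar a b x y = act b x (charge_at a b) y.
Proof.
rewrite /letter_law /belief_policy nth_mkseq //.
by rewrite nth_rcons size_tuple ltnn eqxx.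
Qed.

Lemma fullm_qstar T b x s y : fullm T b x s y = statem T b x s * act b x s y.
Proof. by apply: fullm_act => a {}b {}x {}y; exact: letter_law_qstar. Qed.

Lemma belief_of_qstar T (b : T.-tuple Y) : outm T b != 0 ->
  belief_of T b = belief Q PX1 PS1 phi0 f b /\ reachable my Q start (belief_of T b) /\
  ((0 < T)%N -> exists p (y : Y) h, [/\ reachable my Q start p, valid_weight y h, 0 < mass h p &
     belief_of T b = post Q p y h]).
Proof.
elim: T b => [|T IH] b.
  have [_ ->] := belief_of0 Q PX1 qstar pmfS b; rewrite (tuple0 b) => _.
  by split=> //; split=> //; exact: reachable_start.
have [g _ gK] := rcons_tuple_bij Y T; rewrite -(gK b); case: (g b) => {b}b y /=.
rewrite outmS => nn; have on := nextm_neq0 stoQ pmfX pmfS qv nn.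
have [eb [rb _]] := IH b on.
have mE := mass_act (@fullm_qstar T) b y.
have mn : mass (kernel_at (act b) y) (belief_of T b) != 0.
  by rewrite mE mulf_neq0 ?invr_eq0.
have m0 : 0 < mass (kernel_at (act b) y) (belief_of T b).
  rewrite lt0r mn mass_ge0 //; first by move=> x s; rewrite /kernel_at; case: (act_adm b x s).
  by have [] := belief_of_pmf stoQ pmfX pmfS qv on.
have hv := valid_weight_kernel y (act_adm b).
rewrite (belief_ofS stoQ pmfX pmfS qv (@fullm_qstar T) nn); split.
  have aE : act b = f (belief_of T b) by rewrite /act -eb.
  by rewrite /belief foldl_rcons -/(belief Q PX1 PS1 phi0 f b) -eb filtE -aE.
split; first exact: reachable_step.
by move=> _; exists (belief_of T b), y, (kernel_at (act b) y).
Qed.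

Lemma MI_law_qstar T : J * T%:R + v start = MI_law T + mean_value qstar T.
Proof.
elim: T => [|T IH]; first by rewrite mulr0 (MI_law0 Q PX1 qstar pmfS) mean_value0.
have Mst : MI_law T.+1 = MI_law T + gain T.
  rewrite MI_lawS; apply: MI_extend_eq.
  - exact: law_ge0.
  - exact: arrival_law_ge0.
  - exact: letter_law_ge0.
  - exact: arrival_law_sum1.
  - exact: letter_law_sum1.
  - exact: letter_law_qstar.
have := mean_value_step qv (@fullm_qstar T) (fun b _ => act_adm b).
have -> : \sum_b outm T b * bellman Q phi0 (act b) v (belief_of T b) = J + mean_value qstar T.
  rewrite -(sum_outm_acoe qv); apply: eq_bigr => b _.
  have [->|on] := eqVneq (outm T b) 0; first by rewrite !mul0r.
  have [eb _] := belief_of_qstar on.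
  by have [_ [_ ->]] := acoe (belief_of_pmf stoQ pmfX pmfS qv on); rewrite /act -eb.
rewrite Mst -natr1 mulrDr mulr1; move: IH; lra.
Qed.

Lemma leakInf_qstar_le B : 
  (forall p (y : Y) h, reachable my Q start p -> valid_weight y h -> 0 < mass h p ->
    - B <= v (post Q p y h)) ->
  (leakInf Q PX1 PS1 qstar <= J%:E)%E.
Proof.
move=> LB; apply: (@limn_esup_le_rate _ _ _ (v start + B)) => T T0.
have Tp : 0 < T%:R :> R by rewrite ltr0n.
rewrite (leakT_MI_law Q PX1 PS1 qv T0) ler_pdivrMr // mulrDl divfK ?gt_eqF //.
have EB : - B <= mean_value qstar T.
  rewrite -[leLHS]mul1r -(sum_outm stoQ pmfX pmfS qv T) mulr_suml; apply: ler_sum => b _.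
  have [->|on] := eqVneq (outm T b) 0; first by rewrite !mul0r.
  rewrite ler_wpM2l //; first exact: (outm_ge0 stoQ pmfX pmfS qv).
  have [_ [_ /(_ T0)[p [y [h [rp hv m0 ->]]]]]] := belief_of_qstar on.
  exact: LB rp hv m0.
have := MI_law_qstar T; lra.
Qed.

End OptimalPolicy.

Lemma optimality_random_demand : (0 < mx)%N -> irreducible Q ->
  (leakInf Q PX1 PS1 qstar <= J%:E)%E /\
  forall q : policy R mx my ms, valid_policy q -> (J%:E <= leakInf Q PX1 PS1 q)%E.
Proof.
move=> mx0 irr; pose C : R := `|J| + #|{: X * S}|%:R.
have C0 : 0 <= C by rewrite addr_ge0.
have [B B0 UB] := value_upper_bound le_mx_my stoQ C0 acoe_value_le
  (irreducible_diag_lt1 ord_max mx0 stoQ irr).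
split; last by move=> q qv; exact: (leakInf_ge qv UB).
have reach := reach_bound_from_upper B0 stoQ acoe_value_le UB.
have [B' _ LB] := value_lower_bound stoQ mx0 le_mx_my (addr_ge0 C0 B0) reach
  (fun i => irreducible_column i mx0 irr) start_pmf.
exact: (leakInf_qstar_le LB).
Qed.

(** At a full battery with demand 0 the letter 0 is forced, so the belief is a fixed point and
    nothing leaks; the optimality equation there reads [J + v p = v p]. *)
Lemma acoe_constant_demand : mx = 0%N -> J = 0.
Proof.
move=> mx0; have xE (x : X) : x = ord0 by apply/val_inj => /=; have := ltn_ord x; lia.
have sumX (F : X -> R) : \sum_x F x = F ord0.
  by rewrite (big_pred1 ord0) // => x; rewrite (xE x) /= eqxx.
pose p (_ : X) (s : S) : R := (s == ord_max)%:R.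
have sumS (F : S -> R) : \sum_s F s * (s == ord_max)%:R = F ord_max.
  rewrite (bigD1 ord_max) //= eqxx mulr1 big1 ?addr0 // => s /negbTE ->; by rewrite mulr0.
have pp : is_pmfXS p.
  split=> [x s|]; first by rewrite ler0n.
  rewrite sumX -[RHS](sumS (fun=> 1)); apply: eq_bigr => s _; by rewrite mul1r.
have [aa [_]] := acoe pp; set a := f p in aa *.
have an (y : Y) : y != ord0 -> a ord0 ord_max y = 0.
  move=> yn; apply/eqP; apply: contraNT yn => /(admissible_feasible aa).
  by rewrite /feasible -val_eqE /=; lia.
have a1 : a ord0 ord_max ord0 = 1.
  have [_ [+ _]] := aa ord0 ord_max; by rewrite (bigD1 ord0) //= big1 ?addr0 //.
have mE y : mass (kernel_at a y) p = a ord0 ord_max y by rewrite /mass sumX sumS.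
rewrite bellman_postE (bigD1 ord0) //= [X in _ + (_ + X)]big1 => [|y yn]; last first.
  by rewrite mE an // mul0r.
have -> : Iact a p = 0.
  rewrite /Iact MIE big1 // => -[x s] _ /=; rewrite big1 // => y _.
  have [es|sn] := eqVneq s ord_max; last by rewrite /p (negbTE sn) !mul0r.
  have [ey|yn] := eqVneq y ord0; last by rewrite (xE x) es an // mulr0 mul0r.
  rewrite (xE x) es ey a1 -mulr_sumr; have [_ [-> _]] := aa ord0 ord_max.
  rewrite (sum_pair (fun x s => p x s * a x s ord0)) sumX.
  have -> : \sum_s p ord0 s * a ord0 s ord0 = 1.
    by rewrite -[RHS]a1 -(sumS (fun s => a ord0 s ord0)); apply: eq_bigr => s' _; rewrite mulrC.
  by rewrite /p eqxx !mulr1 divr1 ln1 mulr0.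
have -> : post Q p (ord0 : Y) (kernel_at a ord0) = p.
  apply: funext => x'; apply: funext => s'; rewrite /post mE a1 divr1 /push sumX.
  rewrite (big_pred1 s') => [|s /=]; last by rewrite !addn0.
  have -> : Q ord0 x' = 1 by rewrite (xE x') -(sto_sum stoQ ord0) sumX.
  rewrite mul1r /kernel_at /p; case: eqP => [->|_]; last by rewrite mulr0.
  by rewrite a1 mulr1.
by rewrite mE a1; lra.
Qed.

(** Only the initial charge is random among the inputs, so the mutual information stays between 0
    and [ms + 1]. *)
Lemma leakInf_constant_demand (q : policy R mx my ms) : mx = 0%N -> valid_policy q ->
  leakInf Q PX1 PS1 q = 0%:E.
Proof.
move=> mx0 qv.
have l0 T := law_ge0 stoQ pmfX pmfS qv (T := T).
have l1 T : \sum_a \sum_b law Q PX1 PS1 q (T := T) a b = 1.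
  rewrite exchange_big -[RHS](sum_outm stoQ pmfX pmfS qv T); exact: eq_bigr.
have cA T : #|{: T.-tuple X * S}| = ms.+1 by rewrite card_prod card_tuple !card_ord mx0 exp1n mul1n.
apply/le_anti/andP; split.
  apply: (@limn_esup_le_rate _ _ _ ms.+1%:R) => T T0.
  rewrite (leakT_MI_law Q PX1 PS1 qv T0) add0r ler_wpM2r ?invr_ge0 // -(cA T).
  exact: MI_le_card.
apply: (@limn_esup_ge_rate _ _ _ 0) => T T0.
rewrite (leakT_MI_law Q PX1 PS1 qv T0) mul0r subr0 divr_ge0 //; exact: MI_ge0.
Qed.

End Optimality.

Unset Implicit Arguments.
Local Open Scope classical_set_scope.

Theorem theorem2 (R : realType) (mx my ms : nat) (Q : 'M[R]_mx.+1)
  (PX1 : 'I_mx.+1 -> R) (PS1 : 'I_ms.+1 -> R)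
  (phi0 : ('I_mx.+1 -> 'I_ms.+1 -> R) -> 'I_my.+1 ->
          ('I_mx.+1 -> 'I_ms.+1 -> 'I_my.+1 -> R) -> 'I_mx.+1 -> 'I_ms.+1 -> R)
  (J : R) (v : ('I_mx.+1 -> 'I_ms.+1 -> R) -> R)
  (f : ('I_mx.+1 -> 'I_ms.+1 -> R) -> 'I_mx.+1 -> 'I_ms.+1 -> 'I_my.+1 -> R) :
  (mx <= my)%N ->
  stochastic Q -> irreducible Q -> aperiodic Q ->
  is_pmf PX1 -> is_pmf PS1 ->
  (forall pi y a, is_pmfXS (phi0 pi y a)) ->
  (forall pi, is_pmfXS pi ->
     admissible (f pi) /\
     (forall a, admissible a -> bellman Q phi0 (f pi) v pi <= bellman Q phi0 a v pi) /\
     J + v pi = bellman Q phi0 (f pi) v pi) ->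
  let qstar := belief_policy Q PX1 PS1 phi0 f in
  [/\ valid_policy qstar,
      (forall q : policy R mx my ms, valid_policy q -> (leakInf Q PX1 PS1 qstar <= leakInf Q PX1 PS1 q)%E)
    & ereal_inf [set leakInf Q PX1 PS1 q | q in @valid_policy R mx my ms] = J%:E].
Proof.
move=> le_mx_my stoQ irr _ pmfX pmfS phi0_pmf acoe qstar.
have qv : valid_policy qstar by exact: (belief_policy_valid stoQ pmfX pmfS phi0_pmf acoe).
have [le_star ge_J] : (leakInf Q PX1 PS1 qstar <= J%:E)%E /\
    forall q : policy R mx my ms, valid_policy q -> (J%:E <= leakInf Q PX1 PS1 q)%E.
  have [mx0|mx_gt0] := posnP mx; last exact: (optimality_random_demand le_mx_my stoQ pmfX pmfS phi0_pmf acoe mx_gt0 irr).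
  have J0 := acoe_constant_demand le_mx_my stoQ acoe mx0.
  split=> [|q qv']; rewrite J0 (leakInf_constant_demand stoQ pmfX pmfS mx0) //.
split=> // [q qv'|]; first exact: le_trans le_star (ge_J q qv').
apply/le_anti/andP; split.
  by apply: le_trans le_star; apply: ereal_inf_lbound; exists qstar.
by apply: le_ereal_inf_tmp => _ [q qv' <-]; exact: ge_J.
Qed.
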